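(* Let $R=R_1\times\cdots\times R_s$ be a finite commutative ring with $1\neq0$, where each $R_i$ is a finite local ring with maximal ideal $M_i$ of order $m_i$, $|R_1|/m_1\le\cdots\le|R_s|/m_s$, and $|R_i|/m_i\equiv1\pmod4$ for all $i$. Let $R_0$ be a finite local ring with maximal ideal $M_0$ of order $m_0$ with $|R_0|/m_0\equiv3\pmod4$. Then: (a) $\mathcal{G}_{R_0}$ is Ramanujan if and only if $|R_0|\ge(m_0+2)^2/4$; (b) $\mathcal{G}_R$ is Ramanujan if and only if $R$ is isomorphic to $\mathbb{F}_5\times\mathbb{F}_5$ or to $\mathbb{F}_q$ for a prime power $q\equiv1\pmod4$; (c) $\mathcal{G}_{R_0\times R}$ is Ramanujan if and only if $R_0\times R$ is isomorphic to $\mathbb{F}_3\times\mathbb{F}_5$, $\mathbb{F}_3\times\mathbb{F}_9$ or $\mathbb{F}_3\times\mathbb{F}_{13}$.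
   Context: A local ring is a commutative ring with a unique maximal ideal. For a finite commutative ring $S$, $S^\times$ is its unit group, $Q_S=\{u^2:u\in S^\times\}$, $T_S=Q_S\cup(-Q_S)$, and the quadratic unitary Cayley graph $\mathcal{G}_S$ has vertex set $S$ with $x,y$ adjacent iff $x-y\in T_S$ (it is regular). $\mathbb{F}_q$ is the finite field of order $q$. A finite $r$-regular graph $G$ is Ramanujan if $\lambda(G)\le2\sqrt{r-1}$, where $\lambda(G)$ is the maximum absolute value of an adjacency eigenvalue of $G$ different from $\pm r$. *)

(* Defs.v *)
From HB Require Import structures.
From mathcomp Require Import all_boot all_order all_algebra all_field.

Set Implicit Arguments.
Unset Strict Implicit.
Unset Printing Implicit Defensive.

Import Order.TTheory GRing.Theory Num.Theory.
Local Open Scope ring_scope.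

(* MathComp provides the ring structure of binary products, but does not join it
   with their finite type structure. *)
HB.instance Definition _ (R S : finComUnitRingType) := Finite.on (R * S)%type.

(* The direct product of finitely many finite commutative rings, with
   componentwise operations. MathComp only provides the binary product of rings
   and, up to a non-canonical definition, powers of a single ring. There are
   s.+1 factors, as the empty product would be the zero ring. *)
Definition prodring (s : nat) (R : 'I_s.+1 -> finComUnitRingType) : Type :=
  {dffun forall i : 'I_s.+1, R i}.

Section ProdRing.
Variables (s : nat) (R : 'I_s.+1 -> finComUnitRingType).

HB.instance Definition _ :=
  Finite.copy (prodring R) {dffun forall i : 'I_s.+1, R i}.

Implicit Types f g h : prodring R.

Definition pr_zero : prodring R := [ffun i => (0 : R i)].
Definition pr_one : prodring R := [ffun i => (1 : R i)].
Definition pr_opp f : prodring R := [ffun i => - f i].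
Definition pr_add f g : prodring R := [ffun i => f i + g i].
Definition pr_mul f g : prodring R := [ffun i => f i * g i].
Definition pr_unit : pred (prodring R) :=
  fun f => [forall i, f i \is a GRing.unit].
Definition pr_inv f : prodring R :=
  if pr_unit f then [ffun i => (f i)^-1] else f.

Fact pr_addA : associative pr_add.
Proof. by move=> f g h; apply/ffunP=> i; rewrite !ffunE addrA. Qed.
Fact pr_addC : commutative pr_add.
Proof. by move=> f g; apply/ffunP=> i; rewrite !ffunE addrC. Qed.
Fact pr_add0 : left_id pr_zero pr_add.
Proof. by move=> f; apply/ffunP=> i; rewrite !ffunE add0r. Qed.
Fact pr_addN : left_inverse pr_zero pr_opp pr_add.
Proof. by move=> f; apply/ffunP=> i; rewrite !ffunE addNr. Qed.

HB.instance Definition _ :=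
  GRing.isZmodule.Build (prodring R) pr_addA pr_addC pr_add0 pr_addN.

Fact pr_mulA : associative pr_mul.
Proof. by move=> f g h; apply/ffunP=> i; rewrite !ffunE mulrA. Qed.
Fact pr_mulC : commutative pr_mul.
Proof. by move=> f g; apply/ffunP=> i; rewrite !ffunE mulrC. Qed.
Fact pr_mul1 : left_id pr_one pr_mul.
Proof. by move=> f; apply/ffunP=> i; rewrite !ffunE mul1r. Qed.
Fact pr_mulD : left_distributive pr_mul pr_add.
Proof. by move=> f g h; apply/ffunP=> i; rewrite !ffunE mulrDl. Qed.
Fact pr_one_neq0 : pr_one != pr_zero.
Proof. by apply/eqP=> /ffunP/(_ ord0)/eqP; rewrite !ffunE oner_eq0. Qed.

HB.instance Definition _ := GRing.Zmodule_isComNzRing.Build (prodring R)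
  pr_mulA pr_mulC pr_mul1 pr_mulD pr_one_neq0.

Fact pr_mulV : {in pr_unit, left_inverse 1 pr_inv *%R}.
Proof.
move=> f Uf; rewrite /pr_inv (Uf : pr_unit f); apply/ffunP=> i.
by rewrite !ffunE mulVr //; have /forallP := Uf; apply.
Qed.
Fact pr_unitP f g : g * f = 1 -> pr_unit f.
Proof.
move=> gf1; apply/forallP=> i; apply/unitrPr; exists (g i).
by have /ffunP/(_ i) := gf1; rewrite !ffunE mulrC.
Qed.
Fact pr_inv_out : {in [predC pr_unit], pr_inv =1 id}.
Proof. by move=> f /negPf nUf; rewrite /pr_inv (nUf : pr_unit f = false). Qed.

HB.instance Definition _ := GRing.ComNzRing_hasMulInverse.Build (prodring R)
  pr_mulV pr_unitP pr_inv_out.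

End ProdRing.

Definition ring_iso (A B : nzRingType) : Prop :=
  exists f : {rmorphism A -> B}, bijective f.

(* The field with q elements is unique up to isomorphism; note that MathComp's
   'F_q is the prime field of order pdiv q, not the field of order q. *)
Definition iso_field (A : nzRingType) (q : nat) : Prop :=
  exists F : finFieldType, #|F| = q /\ ring_iso A F.

Definition iso_field2 (A : nzRingType) (q1 q2 : nat) : Prop :=
  exists F1 F2 : finFieldType,
    [/\ #|F1| = q1, #|F2| = q2 & ring_iso A (F1 * F2)%type].

Definition prime_power (q : nat) : Prop :=
  exists p k : nat, [/\ prime p, (0 < k)%N & q = (p ^ k)%N].

(* Ideals in the sense of idealr_closed are proper. *)
Definition maximal_ideal (R : finComUnitRingType) (M : {set R}) : Prop :=
  idealr_closed M /\
  forall I : {set R}, idealr_closed I -> M \subset I -> I = M.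

(* R is local and its maximal ideal is M. *)
Definition local_ring (R : finComUnitRingType) (M : {set R}) : Prop :=
  maximal_ideal M /\ forall M' : {set R}, maximal_ideal M' -> M' = M.

Definition adjmx (V : finType) (e : rel V) : 'M[algC]_#|V| :=
  \matrix_(i, j) (e (enum_val i) (enum_val j))%:R.

(* Adjacency matrices have integer entries, so all their complex eigenvalues
   belong to algC. *)
Definition eigenvalues (n : nat) (A : 'M[algC]_n) : seq algC :=
  sval (closed_field_poly_normal (char_poly A)).

Lemma mem_eigenvalues (n : nat) (A : 'M[algC]_n) (a : algC) :
  (a \in eigenvalues A) = eigenvalue A a.
Proof.
rewrite eigenvalue_root_char /eigenvalues.
case: closed_field_poly_normal => r /= ->.
by rewrite (monicP (char_poly_monic A)) scale1r root_prod_XsubC.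
Qed.

Definition regular (V : finType) (e : rel V) (r : nat) : Prop :=
  forall x : V, #|[set y | e x y]| = r.

(* The norms in algC are pairwise comparable, so that this maximum is genuine,
   with value 0 if all eigenvalues are r or - r. *)
Definition lambda (V : finType) (e : rel V) (r : nat) : algC :=
  \big[Order.max/0]_(a <- eigenvalues (adjmx e)
                       | (a != r%:R) && (a != - r%:R)) `|a|.

Definition ramanujan (V : finType) (e : rel V) : Prop :=
  exists r : nat, regular e r /\ lambda e r <= 2 * sqrtC (r%:R - 1).

Definition unit_squares (S : finComUnitRingType) : {set S} :=
  [set u ^+ 2 | u : S & u \is a GRing.unit].

Definition qucg_set (S : finComUnitRingType) : {set S} :=
  unit_squares S :|: [set - x | x in unit_squares S].

Definition qucg (S : finComUnitRingType) : rel S :=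
  fun x y => x - y \in qucg_set S.

Section QucgFacts.
Variable S : finComUnitRingType.

Lemma qucg_setN (x : S) : (- x \in qucg_set S) = (x \in qucg_set S).
Proof.
suff sub y : y \in qucg_set S -> - y \in qucg_set S.
  by apply/idP/idP=> [/sub|/sub //]; rewrite opprK.
case/setUP=> [Qy | /imsetP[z Qz ->]]; apply/setUP; last by left; rewrite opprK.
by right; apply: imset_f.
Qed.

Lemma qucg_sym : symmetric (@qucg S).
Proof. by move=> x y; rewrite /qucg -qucg_setN opprB. Qed.

Lemma qucg_irr : irreflexive (@qucg S).
Proof.
have Q0 : (0 : S) \notin unit_squares S.
  apply/imsetP=> -[u /=]; rewrite inE => Uu u0.
  by move: (unitrX 2 Uu); rewrite -u0 unitr0.
move=> x; rewrite /qucg subrr; apply/negP=> /setUP[|/imsetP[y Qy /eqP]].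
  exact/negP.
by rewrite eq_sym oppr_eq0 => /eqP y0; move: Q0; rewrite -y0 Qy.
Qed.

Lemma qucg_regular : regular (@qucg S) #|qucg_set S|.
Proof.
move=> x; rewrite -(card_imset (mem (qucg_set S)) (inj_comp (addrI x) oppr_inj)).
apply: eq_card => y; rewrite inE /qucg; apply/idP/imsetP=> [Txy | [z Tz ->]] /=.
  by exists (x - y); rewrite //= opprB addrC subrK.
by rewrite opprD opprK addrA subrr add0r.
Qed.

End QucgFacts.

(* Main.v *)
(* If -1 is a square in B, the graph of A * B is the tensor product of those of
   A and B, so its eigenvalues are products. For a local ring with residue
   field of order q and maximal ideal of order m, the eigenvalues come from an
   explicit form of the adjacency operator: for q = 3 mod 4 the connection set
   consists of all units and -m is an eigenvalue; for q = 1 mod 4 it consists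
   of the squares, and the Jacobi sum of the quadratic character gives m(-1 +-
   sqrt q)/2. A ring morphism which is onto on units maps the connection set
   onto the connection set with fibres of equal size, so eigenvalues of a
   factor lift to the product, scaled by the ratio of the degrees. Hence if the
   graph is Ramanujan, its degree r satisfies r < 4 (sqrt q - 1)^2 if q = 1 mod
   4 and r < 4 (q - 1)^2 if q = 3 mod 4, for each residue field of order q.
   Since m >= q unless m = 1, very few rings remain; their graphs are bounded
   through polynomials annihilating the adjacency operators of the factors. *)
From HB Require Import structures.
Require Import Defs.
From mathcomp Require Import all_boot all_order all_algebra all_fingroup.
From mathcomp Require Import all_solvable all_field.
From mathcomp Require Import ring zify.

Set Implicit Arguments.
Unset Strict Implicit.
Unset Printing Implicit Defensive.

Import Order.TTheory GRing.Theory Num.Theory.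
Local Open Scope ring_scope.

(** * Adjacency eigenvalues as eigenvalues of a convolution operator on functions *)

Section Convolution.
Variable S : finComUnitRingType.
Implicit Types (T : {set S}) (f g : S -> algC).

(** Convolution with the indicator of [T]. For the connection set this is the adjacency operator,
    acting on functions on the ring instead of row vectors. *)
Definition conv T f (x : S) : algC := \sum_(t in T) f (x - t).

Lemma eq_conv T f g : f =1 g -> conv T f =1 conv T g.
Proof. by move=> fg x; apply: eq_bigr => t _. Qed.

Lemma conv_const T c x : conv T (fun=> c) x = #|T|%:R * c.
Proof. by rewrite /conv sumr_const mulr_natl. Qed.

Lemma convZ T c f x : conv T (fun y => c * f y) x = c * conv T f x.
Proof. by rewrite /conv mulr_sumr. Qed.

Lemma convB T f g x : conv T (fun y => f y - g y) x = conv T f x - conv T g x.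
Proof. by rewrite /conv -sumrB. Qed.

(** Sums of translations of an abelian group commute. This is what later allows common eigenvectors
    of several such operators. *)
Lemma convC T1 T2 f : conv T1 (conv T2 f) =1 conv T2 (conv T1 f).
Proof.
move=> x; rewrite /conv exchange_big /=.
by apply: eq_bigr => t _; apply: eq_bigr => u _; rewrite addrAC.
Qed.

Lemma conv_qucg f x :
  conv (qucg_set S) f x = \sum_y (qucg x y)%:R * f y.
Proof.
rewrite (reindex_inj (inj_comp (addrI x) oppr_inj)) /conv big_mkcond /=.
apply: eq_bigr => t _; rewrite /qucg opprB addrCA subrr addr0.
by case: ifP; rewrite ?mul1r ?mul0r.
Qed.

Definition qucg_eigen (a : algC) :=
  exists f : S -> algC, (exists x, f x != 0) /\
    forall x, conv (qucg_set S) f x = a * f x.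

Lemma eigenvalue_qucg a :
  eigenvalue (adjmx (@qucg S)) a <-> qucg_eigen a.
Proof.
split=> [/eigenvalueP[v vA v0] | [f [[x fx] fA]]].
  exists (fun x => v 0 (enum_rank x)); split.
    apply/existsP; apply: contraR v0 => /existsPn v0; apply/eqP/rowP=> j.
    by rewrite mxE -(enum_valK j); apply/eqP; have := v0 (enum_val j);
      rewrite negbK.
  move=> x; rewrite conv_qucg; have /rowP/(_ (enum_rank x)) := vA.
  rewrite !mxE => <-; rewrite (reindex _ (onW_bij _ (@enum_val_bij S))) /=.
  by apply: eq_bigr => j _; rewrite !mxE enum_rankK enum_valK qucg_sym mulrC.
apply/eigenvalueP; exists (\row_j f (enum_val j)).
  apply/rowP=> j; rewrite !mxE -fA conv_qucg.
  rewrite [RHS](reindex _ (onW_bij _ (@enum_val_bij S))) /=.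
  by apply: eq_bigr => k _; rewrite !mxE qucg_sym mulrC.
apply: contra fx => /eqP/rowP/(_ (enum_rank x)).
by rewrite !mxE enum_rankK => ->.
Qed.

Lemma one_qucg_set : 1 \in qucg_set S.
Proof.
by apply/setUP; left; apply/imsetP; exists 1; rewrite ?inE ?unitr1 ?expr1n.
Qed.

Lemma qucg_degree_gt0 : (0 < #|qucg_set S|)%N.
Proof. by apply/card_gt0P; exists 1; apply: one_qucg_set. Qed.

End Convolution.

(** The order of [algC] is partial, so each comparison with the running maximum needs both terms to
    be real; [0 <= c] covers the initial value 0. *)
Lemma bigmax_norm_le (I : Type) (s : seq I) (P : pred I) (F : I -> algC) c :
  0 <= c ->
  (\big[Order.max/0]_(i <- s | P i) `|F i| <= c) <->
  all (fun i => P i ==> (`|F i| <= c)) s.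
Proof.
move=> c0; elim: s => [|i s IHs]; first by rewrite big_nil.
rewrite big_cons /=; case: (P i) => //=.
rewrite comparable_ge_max.
  by split=> [/andP[-> /IHs]|/andP[-> /IHs]].
apply: real_comparable; first exact: normr_real.
elim/big_rec: _ => [|j x _ xR]; first exact: real0.
by rewrite /Order.max; case: ifP => // _; exact: normr_real.
Qed.

Lemma ramanujanP (S : finComUnitRingType) (r := #|qucg_set S|) :
  ramanujan (@qucg S) <->
  forall a, qucg_eigen S a -> a != r%:R -> a != - r%:R ->
    `|a| ^+ 2 <= 4 * (r%:R - 1).
Proof.
have r1 : 0 <= r%:R - 1 :> algC by rewrite subr_ge0 ler1n qucg_degree_gt0.
have b0 : 0 <= 2 * sqrtC (r%:R - 1) :> algC by rewrite mulr_ge0 ?sqrtC_ge0.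
have bE (a : algC) : (`|a| ^+ 2 <= 4 * (r%:R - 1)) = (`|a| <= 2 * sqrtC (r%:R -
  1)).
  rewrite -[RHS](ler_pXn2r (_ : 0 < 2)%N) ?nnegrE //.
  by rewrite exprMn sqrtCK -natrX.
have main : lambda (@qucg S) r <= 2 * sqrtC (r%:R - 1) <->
    forall a, qucg_eigen S a -> a != r%:R -> a != - r%:R ->
    `|a| ^+ 2 <= 4 * (r%:R - 1).
  rewrite /lambda; split=> [/(bigmax_norm_le _ _ _ b0)/allP h a|h].
    move/eigenvalue_qucg; rewrite -mem_eigenvalues => /h /implyP ha a1 a2.
    by rewrite bE; apply: ha; rewrite a1.
  apply/(bigmax_norm_le _ _ _ b0)/allP=> a;
    rewrite mem_eigenvalues => /eigenvalue_qucg Ea.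
  by apply/implyP=> /andP[a1 a2]; rewrite -bE h.
split=> [[r' [reg h]]|/main h]; last by exists r; split=> //;
  apply: qucg_regular.
(* The degree in the definition is existential; counting the neighbours of 0 forces it to be the
   size of the connection set. *)
by apply/main; rewrite /r -(qucg_regular (0 : S)) (reg 0).
Qed.

(** * Ring morphisms, the group of units in the connection set, and lifted eigenvalues *)

Section Lift.
Variables (S S' : finComUnitRingType) (pi : {rmorphism S -> S'}).

Lemma unit_squares_rmorph (x : S) : x \in unit_squares S ->
  pi x \in unit_squares S'.
Proof.
case/imsetP=> u; rewrite inE => Uu ->; apply/imsetP; exists (pi u).
  by rewrite inE rmorph_unit.
by rewrite rmorphXn.
Qed.

Lemma qucg_set_rmorph (x : S) : x \in qucg_set S -> pi x \in qucg_set S'.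
Proof.
case/setUP=> [/unit_squares_rmorph|/imsetP[y /unit_squares_rmorph Qy ->]].
  by move=> Qx; apply/setUP; left.
by rewrite rmorphN qucg_setN; apply/setUP; left.
Qed.

End Lift.

Section QucgGroup.
Variable S : finComUnitRingType.

Lemma unit_squaresP (x : S) :
  reflect (exists2 u, u \is a GRing.unit & x = u ^+ 2) (x \in unit_squares S).
Proof.
by apply: (iffP imsetP) => -[u]; rewrite ?inE => Uu ->; exists u; rewrite ?inE.
Qed.

Lemma unit_squares_unit (x : S) : x \in unit_squares S -> x \is a GRing.unit.
Proof. by case/unit_squaresP=> u Uu ->; rewrite unitrX. Qed.

Lemma unit_squares1 : (1 : S) \in unit_squares S.
Proof. by apply/unit_squaresP; exists 1; rewrite ?unitr1 ?expr1n. Qed.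

Lemma unit_squaresM (x y : S) :
  x \in unit_squares S -> y \in unit_squares S -> x * y \in unit_squares S.
Proof.
case/unit_squaresP=> u Uu -> /unit_squaresP[v Uv ->].
by apply/unit_squaresP; exists (u * v); rewrite ?unitrM ?Uu ?exprMn.
Qed.

Lemma unit_squaresV (x : S) : x \in unit_squares S -> x^-1 \in unit_squares S.
Proof.
by case/unit_squaresP=> u Uu ->; apply/unit_squaresP; exists u^-1;
  rewrite ?unitrV ?exprVn.
Qed.

Lemma mem_qucg_set (x : S) :
  (x \in qucg_set S) = (x \in unit_squares S) || (- x \in unit_squares S).
Proof.
rewrite inE; congr (_ || _); apply/imsetP/idP=> [[y Qy ->]|];
  first by rewrite opprK.
by move=> Qx; exists (- x); rewrite ?opprK.
Qed.

Lemma qucg_set_unit (x : S) : x \in qucg_set S -> x \is a GRing.unit.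
Proof. by rewrite mem_qucg_set => /orP[]/unit_squares_unit;
  rewrite ?unitrN. Qed.

Lemma qucg_setM (x y : S) :
  x \in qucg_set S -> y \in qucg_set S -> x * y \in qucg_set S.
Proof.
rewrite !mem_qucg_set => /orP[] Qx /orP[] Qy; apply/orP.
- by left; apply: unit_squaresM.
- by right; rewrite -mulrN; apply: unit_squaresM.
- by right; rewrite -mulNr; apply: unit_squaresM.
- by left; rewrite -mulrNN; apply: unit_squaresM.
Qed.

Lemma qucg_setV (x : S) : x \in qucg_set S -> x^-1 \in qucg_set S.
Proof.
rewrite !mem_qucg_set -invrN => /orP[] Qx; apply/orP; first by left;
  apply: unit_squaresV.
by right; apply: unit_squaresV.
Qed.

End QucgGroup.

(** Surjectivity is asked on units only: the connection set consists of signed squares of units, and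
    these lift as soon as units do. *)
Definition unit_lifting (S S' : finComUnitRingType) (pi : {rmorphism S ->
  S'}) :=
  forall u', u' \is a GRing.unit -> exists2 u, u \is a GRing.unit & pi u = u'.

Section LiftEigen.
Variables (S S' : finComUnitRingType) (pi : {rmorphism S -> S'}).
Hypothesis pi_lift : unit_lifting pi.
Local Notation T := (qucg_set S).
Local Notation T' := (qucg_set S').

Lemma qucg_set_lift t' : t' \in T' -> exists2 t, t \in T & pi t = t'.
Proof.
have Qlift x' : x' \in unit_squares S' ->
  exists2 x, x \in unit_squares S & pi x = x'.
  case/unit_squaresP=> u' /pi_lift[u Uu <-] ->; exists (u ^+ 2);
    last by rewrite rmorphXn.
  by apply/unit_squaresP; exists u.
rewrite mem_qucg_set => /orP[]/Qlift[x Qx ex].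
  by exists x; rewrite ?mem_qucg_set ?Qx.
by exists (- x); rewrite ?rmorphN ?ex ?opprK // mem_qucg_set opprK Qx orbT.
Qed.

(* Multiplication by a preimage of t' maps the fibre over 1 onto that of t'. *)
Lemma card_qucg_fibre t' : t' \in T' ->
  #|[set t in T | pi t == t']| = #|[set t in T | pi t == 1]|.
Proof.
move=> /qucg_set_lift[t Tt <-]; have Ut := qucg_set_unit Tt.
rewrite -[RHS](card_imset _ (mulrI Ut)); apply: eq_card => x; rewrite inE.
apply/andP/imsetP=> [[Tx /eqP ex]|[y]].
  exists (t^-1 * x); last by rewrite mulVKr.
  rewrite inE qucg_setM ?qucg_setV //= rmorphM rmorphV // ex mulVr //.
  by rewrite rmorph_unit.
by rewrite inE => /andP[Ty /eqP ey] ->; rewrite rmorphM ey mulr1 qucg_setM.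
Qed.

Lemma conv_lift (f : S' -> algC) x :
  conv T (fun y => f (pi y)) x =
  #|[set t in T | pi t == 1]|%:R * conv T' f (pi x).
Proof.
rewrite /conv mulr_sumr (partition_big pi (mem T')) /=;
  last exact: qucg_set_rmorph.
apply: eq_bigr => t' Tt'; rewrite -(card_qucg_fibre Tt') mulr_natl -sumr_const.
under [RHS]eq_bigl do rewrite inE.
by apply: eq_bigr => t /andP[_ /eqP <-]; rewrite rmorphB.
Qed.

Lemma qucg_degree_lift : #|T| = (#|[set t in T | pi t == 1%R]| * #|T'|)%N.
Proof.
have := conv_lift (fun=> 1) 0; rewrite !conv_const !mulr1 -natrM.
by move/eqP; rewrite eqr_nat => /eqP.
Qed.

Lemma qucg_eigen_lift a : qucg_eigen S' a ->
  qucg_eigen S (a * (#|T|%:R / #|T'|%:R)).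
Proof.
case=> f [[x' fx'] fA].
have T'0 : #|T'|%:R != 0 :> algC by rewrite pnatr_eq0 -lt0n qucg_degree_gt0.
(* As [pi] is not assumed surjective, [f] might vanish on its image; the translate is nonzero at 0,
   which is in the image. *)
pose fx0 := fun z => f (z + x').
exists (fun x => fx0 (pi x)); split.
  by exists 0; rewrite /fx0 rmorph0 add0r.
move=> x; rewrite conv_lift [in RHS]qucg_degree_lift natrM mulfK //.
have -> : conv T' fx0 (pi x) = conv T' f (pi x + x').
  by apply: eq_bigr => t _; rewrite /fx0 addrAC.
by rewrite fA mulrA /fx0 [a * _]mulrC.
Qed.

(** The Ramanujan inequality for the lifted eigenvalue, cleared of denominators. Since the degree is
    scaled by the same ratio, nontrivial eigenvalues stay nontrivial. *)
Lemma ramanujan_lift a : ramanujan (@qucg S) -> qucg_eigen S' a ->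
  a != #|T'|%:R -> a != - #|T'|%:R ->
  (`|a| * #|T|%:R) ^+ 2 <= 4 * (#|T|%:R - 1) * #|T'|%:R ^+ 2.
Proof.
move=> /ramanujanP h /qucg_eigen_lift/h {h} h a1 a2.
have T'0 : 0 < #|T'|%:R :> algC by rewrite ltr0n qucg_degree_gt0.
have T0 : 0 < #|T|%:R :> algC by rewrite ltr0n qucg_degree_gt0.
have u : #|T|%:R / #|T'|%:R != 0 :> algC
  by rewrite mulf_neq0 ?invr_neq0 ?gt_eqF.
have TE : #|T|%:R = #|T'|%:R * (#|T|%:R / #|T'|%:R) :> algC.
  by rewrite mulrCA divff ?mulr1 ?gt_eqF.
have := h; rewrite [X in _ != X]TE [X in _ != - X]TE -mulNr !(inj_eq (mulIf u)).
move=> /(_ a1 a2); rewrite normrM (ger0_norm (divr_ge0 (ltW T0) (ltW T'0)))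
  mulrA.
by rewrite expr_div_n ler_pdivrMr ?exprn_gt0.
Qed.

End LiftEigen.

(** * Invariance under ring isomorphism *)

Section RingIso.
Variables (A B : finComUnitRingType) (phi : {rmorphism A -> B}).
Hypothesis phi_bij : bijective phi.

Lemma unit_lifting_bij : unit_lifting phi.
Proof.
have [psi phiK psiK] := phi_bij; move=> u Uu; exists (psi u) => //.
apply/unitrP; exists (psi u^-1); split; apply: (can_inj phiK).
  by rewrite rmorphM !psiK mulVr ?rmorph1.
by rewrite rmorphM !psiK mulrV ?rmorph1.
Qed.

Lemma qucg_degree_bij : #|qucg_set A| = #|qucg_set B|.
Proof.
rewrite (qucg_degree_lift unit_lifting_bij) -[RHS]mul1n; congr (_ * _)%N.
apply/eqP/cards1P; exists 1; apply/setP=> t; rewrite inE [RHS]inE.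
apply/andP/eqP=> [[_ /eqP e]|->]; last by rewrite one_qucg_set rmorph1.
by apply: (bij_inj phi_bij); rewrite rmorph1.
Qed.

Lemma qucg_eigen_bij a : qucg_eigen A a -> qucg_eigen B a.
Proof.
have [psi phiK psiK] := phi_bij.
case=> f [[x fx] fA]; exists (fun y => f (psi y)); split.
  by exists (phi x); rewrite phiK.
move=> y; rewrite -(psiK y) phiK -fA.
have := conv_lift unit_lifting_bij (fun z => f (psi z)) (psi y).
have /eqP := qucg_degree_lift unit_lifting_bij.
rewrite qucg_degree_bij -[X in X == _]mul1n eqn_pmul2r ?qucg_degree_gt0 // =>
  /eqP <-.
by rewrite mul1r => <-; apply: eq_conv => z; rewrite phiK.
Qed.

End RingIso.

Lemma ramanujan_iso (A B : finComUnitRingType) :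
  ring_iso A B -> ramanujan (@qucg B) -> ramanujan (@qucg A).
Proof.
case=> phi phi_bij /ramanujanP h; apply/ramanujanP=> a.
by rewrite (qucg_degree_bij phi_bij) => /(qucg_eigen_bij phi_bij)/h.
Qed.

(** * Finite local rings: counting units, squares, and the position of -1 *)

Definition nonunits (S : finComUnitRingType) : {set S} :=
  [set x | x \isn't a GRing.unit].

Definition is_local (S : finComUnitRingType) : Prop :=
  {in nonunits S &, forall x y, x + y \in nonunits S}.

Section LocalRing.
Variable S : finComUnitRingType.
Implicit Types x y u v : S.

(** A proper ideal is enlarged until no larger one exists, by induction on the size of its
    complement. Being an ideal is spelled out as a boolean so that the existence of a larger one can
    be decided. *)
Lemma maximal_ideal_exists (I : {set S}) : idealr_closed I ->
  exists2 M : {set S}, maximal_ideal M & I \subset M.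
Proof.
have [n] := ubnP #|~: I|; elim: n I => // n IHn I ltIn idI.
have [/existsP[J /andP[/and3P[J0 J1 /'forall_'forall_'forall_implyP clJ]
  IJ]]|noJ] :=
  boolP [exists J : {set S}, [&& 0 \in J, 1 \notin J & [forall a, [forall x,
    [forall y,
    (x \in J) && (y \in J) ==> (a * x + y \in J)]]]] && (I \proper J)].
  have idJ : idealr_closed J.
    by split=> // a x y Jx Jy; have := clJ a x y; rewrite Jx Jy; apply.
  have [|M maxM JM] := IHn J _ idJ.
    by rewrite -ltnS (leq_trans _ ltIn) // ltnS proper_card // properC.
  by exists M => //; apply: subset_trans JM; apply: proper_sub.
exists I => //; split=> // J idJ IJ; apply/eqP; apply: contraR noJ => neJI.
have [J0 J1 clJ] := idJ.
apply/existsP; exists J; rewrite J0 J1 properEneq IJ eq_sym neJI /= andbT.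
by apply/'forall_'forall_'forall_implyP=> a x y /andP[Jx Jy]; apply: clJ.
Qed.

Lemma principal_ideal x : x \in nonunits S ->
  idealr_closed [set a * x | a : S].
Proof.
rewrite inE => Ux; split.
- by apply/imsetP; exists 0; rewrite ?mul0r.
- apply: contra Ux => /imsetP[a _ ax]; apply/unitrP; exists a.
  by rewrite [x * a]mulrC -ax.
- move=> a _ _ /imsetP[b _ ->] /imsetP[c _ ->]; apply/imsetP.
  by exists (a * b + c); rewrite // mulrDl mulrA.
Qed.

(** A proper ideal contains no unit. Conversely a nonunit generates a proper ideal, which lies in
    some maximal ideal, and this is [M] by uniqueness. *)
Lemma local_ringE (M : {set S}) : local_ring M -> M = nonunits S.
Proof.
case=> -[[M0 M1 clM] maxM] uniqM; apply/setP=> x; apply/idP/idP=> [Mx|Nx].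
  rewrite inE; apply: contra M1 => Ux.
  by rewrite -(mulVr Ux) -[_ * _]addr0 clM.
have [M' maxM' /subsetP sub] := maximal_ideal_exists (principal_ideal Nx).
by rewrite -(uniqM M') //; apply: sub; apply/imsetP; exists 1; rewrite ?mul1r.
Qed.

Lemma local_ring_is_local (M : {set S}) : local_ring M -> is_local S.
Proof.
move=> locM; rewrite /is_local -(local_ringE locM).
by case: locM => -[[M0 M1 clM] _] _ x y Mx My; rewrite -[x]mul1r clM.
Qed.

Lemma nonunits0 : 0 \in nonunits S.
Proof. by rewrite inE unitr0. Qed.

Lemma nonunitsM x y : x \in nonunits S -> y * x \in nonunits S.
Proof. by rewrite !inE unitrM negb_and => ->; rewrite orbT. Qed.

Hypothesis localS : is_local S.
Local Notation M := (nonunits S).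
Local Notation U := [set u : S | u \is a GRing.unit].
Local Notation m := #|M|.
Local Notation q := (#|S| %/ m)%N.

Lemma nonunitsN x : (- x \in M) = (x \in M).
Proof. by rewrite !inE unitrN. Qed.

Lemma nonunitsD x y : y \in M -> (x + y \in M) = (x \in M).
Proof.
move=> My; apply/idP/idP=> Mx; last exact: localS.
by rewrite -(addrK y x) localS ?nonunitsN.
Qed.

Lemma unitD x y : y \in M -> (x + y \is a GRing.unit) = (x \is a GRing.unit).
Proof. by move=> /(nonunitsD x); rewrite !inE => /negb_inj. Qed.

Lemma nonunits_group_set : group_set M.
Proof. by apply/group_setP; split=> [|x y];
  [apply: nonunits0 | apply: localS]. Qed.

Canonical nonunits_group := Group nonunits_group_set.

Lemma card_nonunits_gt0 : (0 < m)%N.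
Proof. by apply/card_gt0P; exists 0; apply: nonunits0. Qed.

Lemma card_local : #|S| = (q * m)%N.
Proof.
by rewrite divnK // -cardsT (@cardSg S [group of setT] nonunits_group) //
  subsetT.
Qed.

Lemma card_units : #|U| = (q.-1 * m)%N.
Proof.
have -> : U = ~: M by apply/setP=> x; rewrite !inE negbK.
have := cardsC M; rewrite [RHS]card_local -subn1 mulnBl mul1n => <-.
by rewrite addKn.
Qed.

(** Lagrange in the additive quotient group of S by M: it has order q, so q times the class of 1 is
    trivial. *)
Lemma residue_natr : q%:R \in M.
Proof.
have nM : ([group of [set: S]] \subset 'N(nonunits_group))%g.
  apply: sub_abelian_norm; last exact: subsetT.
  by apply/centsP=> x _ y _; apply: FinRing.zmod_mulgC.
have qE : #|[group of [set: S]] / nonunits_group|%g = q.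
  rewrite card_quotient // -divgS ?subsetT //= cardsT //.
have := @expg_cardG _ ([group of [set: S]] / nonunits_group)%G (coset
  nonunits_group (1%R : S)).
rewrite qE => /(_ (mem_quotient _ _)) h.
have N x : (x \in 'N(nonunits_group))%g by rewrite (subsetP nM) ?inE.
apply: (coset_idr (N _)); rewrite -[q%:R]/((1%R : S) ^+ q)%g morphX ?N //.
by rewrite h ?inE.
Qed.

Hypothesis q_odd : odd q.

(** If 2 were in M, so would be 1, the difference of q, which is in M, and an even number. *)
Lemma two_unit : (2 : S) \is a GRing.unit.
Proof.
apply: contraT => n2; have M2 : (2 : S) \in M by rewrite inE.
have : (1 : S) \in M.
  rewrite -(nonunitsD 1 (nonunitsM q./2%:R M2)) -natrM -(natrD _ 1) muln2.
  by rewrite -[1%N]/(nat_of_bool true) -q_odd odd_double_half residue_natr.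
by rewrite inE unitr1.
Qed.


Local Notation Q := (unit_squares S).

(** From (u - 1)(u + 1) = 0: if neither factor were a unit, their difference 2 would be a
    nonunit. *)
Lemma sqr_eq1 u : u ^+ 2 = 1 -> u = 1 \/ u = -1.
Proof.
move=> u2; have : (u - 1) * (u + 1) = 0 by rewrite -subr_sqr_1 u2 subrr.
have [U1 /(canRL (mulKr U1))|N1 e0] := boolP (u - 1 \is a GRing.unit).
  by rewrite mulr0 => /(canRL (addrK _)); rewrite sub0r; right.
left; have [U2|N2] := boolP (u + 1 \is a GRing.unit).
  by move/(canRL (mulrK U2)): e0; rewrite mul0r => /(canRL (subrK _));
    rewrite add0r.
have : (u + 1) - (u - 1) \in M by rewrite localS ?nonunitsN // inE.
by rewrite opprB addrC addrA subrK inE two_unit.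
Qed.

Lemma sqr_inj_sign u v : v \is a GRing.unit -> u ^+ 2 = v ^+ 2 ->
  u = v \/ u = - v.
Proof.
move=> Uv uv; have : (u / v) ^+ 2 = 1 by rewrite expr_div_n uv divrr // unitrX.
by case/sqr_eq1 => /(canRL (divrK Uv)) ->; [left; rewrite mul1r | right;
  rewrite mulN1r].
Qed.

Lemma unit_neqN u : u \is a GRing.unit -> u != - u.
Proof.
move=> Uu; rewrite -addr_eq0 -mulr2n -mulr_natl.
have : 2 * u \is a GRing.unit by rewrite unitrM two_unit.
by apply: contraL => /eqP->; rewrite unitr0.
Qed.

(** The fibre of squaring over u^2 is {u, -u}, and u differs from -u because 2 is a unit. *)
Lemma card_units_squares : #|U| = (#|Q| * 2)%N.
Proof.
rewrite -sum1_card (partition_big (fun u => u ^+ 2) (mem Q)) /=; last first.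
  by move=> u; rewrite inE => Uu; apply/unit_squaresP; exists u.
rewrite -sum_nat_const; apply: eq_bigr => _ /unit_squaresP[u Uu ->].
rewrite sum1dep_card -[RHS]/(true.+1) -(unit_neqN Uu) -cards2;
  apply: eq_card => v.
rewrite !inE; apply/andP/orP=> [[Uv /eqP/(sqr_inj_sign Uu)[]->]|].
- by left.
- by right.
by case=> /eqP->; rewrite ?unitrN Uu ?sqrrN eqxx.
Qed.

Lemma unit_squares_mulE u v : u \is a GRing.unit -> v \is a GRing.unit ->
  (u * v \in Q) = ((u \in Q) == (v \in Q)).
Proof.
have QU : Q \subset U by apply/subsetP=> x /unit_squares_unit; rewrite inE.
have QM x y : x \in Q -> y \is a GRing.unit -> (x * y \in Q) = (y \in Q).
  move=> Qx Uy; apply/idP/idP=> Qy; last exact: unit_squaresM.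
  by rewrite -(mulKr (unit_squares_unit Qx) y) unit_squaresM ?unit_squaresV.
move=> Uu Uv; have [Qu|nQu] := boolP (u \in Q).
  by rewrite QM //; case: (v \in Q).
have [Qv|nQv] := boolP (v \in Q); first by rewrite mulrC QM // (negPf nQu).
(* For a nonsquare u the coset u Q consists of nonsquare units. As squares are half of the units it
   exhausts them, so the product of two nonsquares is u^2 times a square. *)
have e : [set u * x | x in Q] = U :\: Q.
  apply/eqP; rewrite eqEcard; apply/andP; split.
    apply/subsetP=> _ /imsetP[x Qx ->]; rewrite !inE mulrC QM // nQu /=.
    by rewrite unitrM Uu (unit_squares_unit Qx).
  rewrite card_imset; last exact: mulrI.
  by rewrite cardsD (setIidPr QU) card_units_squares muln2 -addnn addnK.
have : v \in U :\: Q by rewrite inE nQv inE.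
rewrite -e => /imsetP[x Qx ->]; rewrite mulrA unit_squaresM //.
by apply/unit_squaresP; exists u; rewrite ?expr2.
Qed.

(** Squaring is injective on 1 + M, hence permutes this finite set, and 1 + M consists of squares.
    Then z + a = z (1 + a / z) is a square whenever z is one and a is in M. *)
Lemma unit_squaresD x y : y \in M -> (x + y \in Q) = (x \in Q).
Proof.
have oneM : [set u ^+ 2 | u in [set 1 + a | a in M]] = [set 1 + a | a in M].
  apply/eqP; rewrite eqEcard; apply/andP; split.
    apply/subsetP=> _ /imsetP[_ /imsetP[a Ma ->] ->]; apply/imsetP.
    exists (2 * a + a * a); last by ring.
    by rewrite localS ?nonunitsM.
  rewrite [leqRHS]card_in_imset // => _ _ /imsetP[a Ma ->] /imsetP[b Mb ->] ab.
  have Ub : 1 + b \is a GRing.unit by rewrite unitD ?unitr1.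
  have [//|e] := sqr_inj_sign Ub ab.
  have : 2 + (a + b) \in M by rewrite -[2 + _]/(1 + 1 + (a + b)) addrACA e
    addNr nonunits0.
  by rewrite (nonunitsD _ (localS Ma Mb)) inE two_unit.
have sub z a : z \in Q -> a \in M -> z + a \in Q.
  move=> Qz Ma; have Uz := unit_squares_unit Qz.
  rewrite -[z + a](mulVKr Uz) unit_squaresM // mulrDr mulVr //.
  have : 1 + z^-1 * a \in [set 1 + a | a in M] by apply: imset_f;
    rewrite nonunitsM.
  rewrite -oneM => /imsetP[_ /imsetP[b Mb ->] ->]; apply/unit_squaresP.
  by exists (1 + b); rewrite ?unitD ?unitr1.
move=> My; apply/idP/idP=> Qx; last exact: sub.
by rewrite -(addrK y x) sub ?nonunitsN.
Qed.

(** Otherwise Cauchy's theorem in the additive group M gives x of order 2, but 2 x = 0 with 2 a unit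
    forces x = 0. *)
Lemma odd_nonunits : odd m.
Proof.
apply: contraT; rewrite -dvdn2 => m2.
have [x Mx ox] := @Cauchy _ 2 nonunits_group isT m2; have := expg_order x.
rewrite ox -[(x ^+ 2)%g]/(x *+ 2) -[1%g]/(0 : S) -mulr_natl.
move/(canRL (mulKr two_unit)); rewrite mulr0 => x0.
by move: ox; rewrite x0 -[(0 : S)]/(1%g : S) order1.
Qed.

Lemma unit_squares_group_set : group_set [set u : {unit S} | val u \in Q].
Proof.
apply/group_setP; split=> [|u v]; first by rewrite inE unit_squares1.
by rewrite !inE; apply: unit_squaresM.
Qed.

(** If -1 = u^2 then u has order 4, so 4 divides (q - 1) m with m odd. Conversely, if 4 divides q -
    1 then the group of squares has even order, and an involution in it can only be -1. *)
Lemma minus1_square : ((-1 : S) \in Q) = (q %% 4 == 1)%N.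
Proof.
have cU : #|[set: {unit S}]| = #|U|.
  by rewrite cardsT card_sub; apply: eq_card => x; rewrite [RHS]inE.
have q1E : (q %% 4 == 1)%N = (4 %| q.-1)%N.
  by rewrite -subn1 -eqn_mod_dvd ?(odd_gt0 q_odd).
rewrite q1E; apply/idP/idP=> [/unit_squaresP[u Uu u2]|q4].
  have ou : #[FinRing.unit S Uu]%g = 4%N.
    apply: (@orderXprime _ 2 2) => //; apply: nt_prime_order => //.
      by apply: val_inj; rewrite /= -!expr2 -u2 sqrrN expr1n.
    by rewrite -val_eqE /= -expr2 -u2 eq_sym unit_neqN ?unitr1.
  have : (4 %| q.-1 * m)%N.
    by rewrite -card_units -cU -ou; apply: order_dvdG; apply: in_setT.
  have co : coprime (2 ^ 2) m.
    by rewrite coprimeXl // prime_coprime // dvdn2 odd_nonunits.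
  by rewrite (Gauss_dvdl _ (co : coprime 4 m)).
have evQ : (2 %| #|[set u : {unit S} | val u \in Q]|)%N.
  have -> : #|[set u : {unit S} | val u \in Q]| = #|Q|.
    rewrite -(card_imset _ val_inj); apply: eq_card => x; apply/imsetP/idP.
      by case=> u; rewrite inE => Qu ->.
    by move=> Qx; exists (FinRing.unit S (unit_squares_unit Qx)); rewrite ?inE.
  rewrite -(@dvdn_pmul2r 2) // -card_units_squares card_units.
  exact: dvdn_mulr q4.
have [u] := @Cauchy _ 2 (Group unit_squares_group_set) isT evQ.
rewrite inE => Qu ou; have := expg_order u; rewrite ou => /(congr1 val) /=.
case/sqr_eq1=> [u1|<-//].
have : u = 1%g by apply: val_inj.
by move=> u1'; rewrite u1' order1 in ou.
Qed.

End LocalRing.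

(** * Explicit eigenvectors for local rings *)

Section LocalSpectrum.
Variable S : finComUnitRingType.
Hypothesis localS : is_local S.
Local Notation M := (nonunits S).
Local Notation U := [set u : S | u \is a GRing.unit].
Local Notation Q := (unit_squares S).
Local Notation m := #|M|.
Local Notation q := (#|S| %/ m)%N.
Implicit Types (x y t d : S) (f : S -> algC).

(** For a nonzero x in M, multiplication by x maps S into M, and each nonempty fibre is a translate
    of the annihilator of x, itself contained in M. Hence |S| <= m * m. *)
Lemma residue_le_nonunits : (1 < m)%N -> (q <= m)%N.
Proof.
case/card_gt1P=> y [z [My Mz yz]].
have [x Mx x0] : exists2 x, x \in M & x != 0.
  have [y0|y0] := eqVneq y 0; last by exists y.
  by exists z; rewrite // -y0 eq_sym.
rewrite -(leq_pmul2r (card_nonunits_gt0 S)) -card_local // -[leqLHS]sum1_card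
  -[leqRHS]sum_nat_const.
rewrite (partition_big (fun a => a * x) (mem M)) => [|a _];
  last exact: nonunitsM.
apply: leq_sum => b Mb; rewrite sum1dep_card.
have [->|/set0Pn[a]] := eqVneq [set a | a * x == b] set0;
  first by rewrite cards0.
rewrite inE => /eqP ab; rewrite -[leqLHS](card_imset _ (@addIr _ (- a))).
apply/subset_leq_card/subsetP=> _ /imsetP[c Fc ->].
have cb : c * x = b by apply/eqP; rewrite inE in Fc.
rewrite inE; apply: contra x0 => Uca; apply/eqP/(mulrI Uca).
by rewrite mulr0 mulrBl ab cb subrr.
Qed.

Definition nonunit_ind x : algC := (x \in M)%:R.

Lemma sum_nonunits f : \sum_t nonunit_ind t * f t = \sum_(t in M) f t.
Proof.
rewrite [RHS]big_mkcond; apply: eq_bigr => t _; rewrite /nonunit_ind.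
by case: (t \in M); rewrite ?mul1r ?mul0r.
Qed.

Lemma nonunit_indD x y : y \in M -> nonunit_ind (x + y) = nonunit_ind x.
Proof. by move=> My; rewrite /nonunit_ind nonunitsD. Qed.

Lemma conv_nonunits f x :
  (forall y, y \in M -> f (x + y) = f x) -> conv M f x = m%:R * f x.
Proof.
move=> fM; rewrite mulr_natl -sumr_const; apply: eq_bigr => t Mt.
by rewrite fM ?nonunitsN.
Qed.

Section ThreeMod4.
Hypothesis q3 : (q %% 4 = 3)%N.

Lemma residue_odd3 : odd q.
Proof. by rewrite (divn_eq q 4) q3 oddD oddM andbF. Qed.

Lemma minus1_nonsquare : ((-1 : S) \in Q) = false.
Proof. by rewrite minus1_square ?residue_odd3 // q3. Qed.

Lemma qucg_set3 : qucg_set S = U.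
Proof.
have N1 := minus1_nonsquare; have qo := residue_odd3.
apply/setP=> x; rewrite mem_qucg_set inE; apply/idP/idP.
  by case/orP=> /unit_squares_unit; rewrite ?unitrN.
move=> Ux; rewrite -mulN1r unit_squares_mulE ?unitrN ?unitr1 // N1.
by case: (x \in Q).
Qed.

Lemma qucg_degree3 : #|qucg_set S| = (q.-1 * m)%N.
Proof. by rewrite qucg_set3 card_units. Qed.

Lemma conv_units f x : conv U f x = \sum_t f t - conv M f x.
Proof.
rewrite (reindex_inj (inj_comp (addrI x) oppr_inj)) /= (bigID (mem M)) /=.
by rewrite addrC addrK; apply: eq_bigl => t; rewrite !inE negbK.
Qed.

Lemma qucg_eigen3 : qucg_eigen S (- m%:R).
Proof.
have M1 : (1 : S) \notin M by rewrite inE unitr1.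
have sumM x0 : \sum_t nonunit_ind (t - x0) = m%:R.
  rewrite (reindex_inj (addIr x0)) /=;
    under eq_bigr do rewrite addrK -[nonunit_ind _]mulr1.
  by rewrite sum_nonunits sumr_const.
(* The difference of the indicators of M and 1 + M has sum zero and is constant on cosets of M, so
   the total sum minus [conv M] acts on it as -m. *)
exists (fun x => nonunit_ind x - nonunit_ind (x - 1)); split.
  by exists 0; rewrite /nonunit_ind nonunits0 sub0r nonunitsN // (negPf M1)
    subr0 oner_eq0.
move=> x; rewrite qucg_set3 conv_units conv_nonunits => [|y My]; last first.
  by rewrite addrAC !(nonunit_indD _ My).
have -> : \sum_t (nonunit_ind t - nonunit_ind (t - 1)) = 0.
  have s0 : \sum_t nonunit_ind t = m%:R.
    by rewrite -(sumM 0); apply: eq_bigr => t _; rewrite subr0.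
  by rewrite sumrB sumM s0 subrr.
by rewrite sub0r mulNr.
Qed.

End ThreeMod4.

Section OneMod4.
Hypothesis q1 : (q %% 4 = 1)%N.

Lemma residue_odd1 : odd q.
Proof. by rewrite (divn_eq q 4) q1 oddD oddM andbF. Qed.
Let qo := residue_odd1.

Lemma minus1_square1 : (-1 : S) \in Q.
Proof. by rewrite minus1_square ?qo // q1. Qed.

Lemma qucg_set1 : qucg_set S = Q.
Proof.
have N1 := minus1_square1.
apply/setP=> x; rewrite mem_qucg_set -mulN1r; apply/orP/idP; last by left.
by case=> // /(unit_squaresM N1); rewrite mulrA mulrNN !mul1r.
Qed.

Lemma qucg_degree1 : (#|qucg_set S| * 2 = q.-1 * m)%N.
Proof. by rewrite qucg_set1 -card_units_squares // card_units. Qed.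

(** The quadratic character of the residue field pulled back to [S]: 1 on squares of units, -1 on
    the other units, 0 on nonunits. *)
Definition qchar x : algC := (x \in Q)%:R *+ 2 - (x \is a GRing.unit)%:R.

Lemma qchar_square x : x \in Q -> qchar x = 1.
Proof. by move=> Qx; rewrite /qchar Qx (unit_squares_unit Qx) mulr2n addrK. Qed.

Lemma qchar_nonunit x : x \in M -> qchar x = 0.
Proof.
rewrite inE /qchar => nUx; have [/unit_squares_unit Ux|_] := boolP (x \in Q).
  by rewrite Ux in nUx.
by rewrite (negPf nUx) mul0rn subr0.
Qed.

Lemma qcharM x y : qchar (x * y) = qchar x * qchar y.
Proof.
have [Ux|nx] := boolP (x \is a GRing.unit); last first.
  by rewrite (@qchar_nonunit x) ?inE // mul0r qchar_nonunit ?inE // unitrM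
    (negPf nx).
have [Uy|ny] := boolP (y \is a GRing.unit); last first.
  by rewrite (@qchar_nonunit y) ?inE // mulr0 qchar_nonunit ?inE // unitrM
    (negPf ny) andbF.
rewrite /qchar unit_squares_mulE // unitrM Ux Uy /=.
by case: (x \in Q); case: (y \in Q) => /=; ring.
Qed.

Lemma qcharN x : qchar (- x) = qchar x.
Proof. by rewrite -mulN1r qcharM qchar_square ?mul1r ?minus1_square1. Qed.

Lemma qcharD x y : y \in M -> qchar (x + y) = qchar x.
Proof. by move=> My; rewrite /qchar unit_squaresD // unitD. Qed.

Lemma sum_indicator (A : {set S}) : \sum_t (t \in A)%:R = #|A|%:R :> algC.
Proof. by rewrite -sumr_const [RHS]big_mkcond; apply: eq_bigr => t _;
  case: ifP. Qed.

Lemma sum_qchar : \sum_t qchar t = 0.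
Proof.
rewrite sumrB sumrMnl sum_indicator.
have -> : \sum_(t : S) (t \is a GRing.unit)%:R = #|U|%:R :> algC.
  by rewrite -sum_indicator; apply: eq_bigr => t _; rewrite inE.
by rewrite card_units_squares // natrM mulr_natr subrr.
Qed.

Lemma sum_units f :
  (forall t, t \in M -> f t = 0) -> \sum_t f t = \sum_(t in U) f t.
Proof.
move=> f0; rewrite [RHS]big_mkcond; apply: eq_bigr => t _; rewrite inE.
by case: ifPn => // nUt; rewrite f0 // inE.
Qed.

Lemma qchar_sqr x : x \is a GRing.unit -> qchar x * qchar x = 1.
Proof. by move=> Ux; rewrite -qcharM qchar_square //; apply/unit_squaresP;
  exists x; rewrite ?expr2. Qed.

(* The Jacobi sum of the quadratic character; for a unit d, substitute
   t = d / s and use that the character takes the same value at t and 1 / t. *)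
Lemma qchar_convolution d :
  \sum_t qchar t * qchar (d - t) = m%:R * (q%:R * nonunit_ind d - 1).
Proof.
rewrite sum_units => [|t Mt]; last by rewrite qchar_nonunit ?mul0r.
have [Md|Ud] := boolP (d \in M).
  under eq_bigr => t.
    rewrite inE => Ut; rewrite addrC qcharD // qcharN qchar_sqr //; over.
  rewrite sumr_const card_units // /nonunit_ind Md mulr1 mulrC natrM.
  by rewrite -subn1 natrB // odd_gt0 // qo.
rewrite /nonunit_ind (negPf Ud) mulr0 sub0r mulrN1.
have {}Ud : d \is a GRing.unit by move: Ud; rewrite inE negbK.
transitivity (\sum_(t in U) qchar (t - 1)).
  rewrite (reindex_inj (inj_comp (mulrI Ud) (inv_inj (@invrK S)))) /=.
  apply: eq_big => [t|t]; rewrite !inE unitrM unitrV Ud //= => Ut.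
  have -> : d - d / t = d / t * (t - 1) by rewrite mulrBr divrK ?mulr1.
  by rewrite qcharM mulrA qchar_sqr ?mul1r // unitrM unitrV Ud.
have sumU : \sum_t qchar (t - 1) = 0.
  by rewrite -[RHS]sum_qchar [RHS](reindex_inj (addIr (-1))).
move: sumU; rewrite (bigID (mem M)) /=.
under eq_bigr => t Mt do rewrite addrC qcharD // qcharN qchar_square
  ?unit_squares1 //.
rewrite sumr_const => /eqP; rewrite addrC addr_eq0 => /eqP <-.
by apply: eq_bigl => t; rewrite !inE negbK.
Qed.

(** The indicator of the squares is half the sum of [qchar] and the indicator of the units. *)
Lemma conv_squares f x :
  conv Q f x = (\sum_t f t - conv M f x + \sum_t qchar t * f (x - t)) / 2.
Proof.
rewrite -[\sum_t f t - _]conv_units /conv !(big_mkcond (fun t => t \in _)) /=.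
rewrite -big_split mulr_suml; apply: eq_bigr => t _; rewrite inE /qchar /=.
have [/unit_squares_unit ->|_] := boolP (t \in Q); first by rewrite /=; field.
by case: (t \is a _) => /=; field.
Qed.

(** Modulo constants, convolution with [qchar] sends [qchar] to m q [nonunit_ind], and [nonunit_ind]
    to m [qchar]. This combination is its eigenvector for -m sqrt q. *)
Let eta x : algC := qchar x - sqrtC q%:R * nonunit_ind x.

Lemma conv_eta x :
  conv Q eta x = - (m%:R * (1 + sqrtC q%:R) / 2) * (eta x + 1).
Proof.
have sumM : \sum_t nonunit_ind t = m%:R := sum_indicator M.
have sM : \sum_t qchar t * nonunit_ind (x - t) = m%:R * qchar x.
  rewrite (reindex_inj (inj_comp (addrI x) oppr_inj)) /=.
  under eq_bigr do rewrite opprB addrCA subrr addr0 mulrC.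
  by rewrite sum_nonunits -/(conv M qchar x) conv_nonunits // => y My;
    rewrite qcharD.
rewrite conv_squares conv_nonunits => [|y My];
  last by rewrite /eta qcharD ?nonunit_indD.
have -> : \sum_t qchar t * eta (x - t) =
    m%:R * (q%:R * nonunit_ind x - 1) - sqrtC q%:R * (m%:R * qchar x).
  rewrite -qchar_convolution -sM mulr_sumr -sumrB.
  by apply: eq_bigr => t _; rewrite /eta; ring.
rewrite sumrB sum_qchar -mulr_sumr sumM /eta -[q%:R * _]/(q%:R * _).
have -> : q%:R * nonunit_ind x = sqrtC q%:R ^+ 2 * nonunit_ind x
  by rewrite sqrtCK.
by field.
Qed.

Lemma qucg_eigen1 : qucg_eigen S (- (m%:R * (1 + sqrtC q%:R) / 2)).
Proof.
(* Subtracting a translate cancels the constant left over in [conv_eta]. *)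
exists (fun x => eta x - eta (x - 1)); split.
  exists 0; rewrite /eta sub0r qcharN (@qchar_nonunit 0) ?nonunits0 //.
  rewrite (@qchar_square 1) ?unit_squares1 // /nonunit_ind nonunits0 nonunitsN
    // inE unitr1.
  rewrite mulr1 mulr0 subr0 sub0r -opprD oppr_eq0 gt_eqF //.
  by rewrite ltr_wpDl ?ltr01 ?sqrtC_ge0 ?ler0n.
move=> x; rewrite qucg_set1 convB conv_eta.
have -> : conv Q (fun y => eta (y - 1)) x = conv Q eta (x - 1).
  by apply: eq_bigr => t _; rewrite addrAC.
by rewrite conv_eta; ring.
Qed.

End OneMod4.
End LocalSpectrum.

(** * Annihilating polynomials, spectra of binary products, and Ramanujan criteria *)

Section Annihilation.
Variable V : finType.
Implicit Types (f g : V -> algC) (L : (V -> algC) -> V -> algC) (s : seq algC).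

Definition shift_op L a f : V -> algC := fun x => L f x - a * f x.

(* The product of the operators L - a, for a in s. *)
Definition poly_op L s f : V -> algC := foldr (shift_op L) f s.

(** When the whole product kills [f], the last nonzero partial product is an eigenvector. The
    invariant [P] carries eigen-equations of commuting operators along, so that common eigenvectors
    are built one operator at a time. *)
Lemma poly_op_eigen L (P : (V -> algC) -> Prop) s f :
  (forall a g, P g -> P (shift_op L a g)) ->
  P f -> (exists x, f x != 0) -> (forall x, poly_op L s f x = 0) ->
  exists2 a, a \in s & exists g,
    [/\ P g, exists x, g x != 0 & forall x, L g x = a * g x].
Proof.
move=> Pop Pf f0; elim: s => [|a s IHs] /= Ls.
  by case: f0 => x; rewrite Ls eqxx.
have Ps : P (poly_op L s f) by elim: s {IHs Ls} => //= b s; apply: Pop.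
have [/existsP nz|/existsPn z] := boolP [exists x, poly_op L s f x != 0].
  exists a; first exact: mem_head.
  by exists (poly_op L s f); split=> // x; apply/eqP; rewrite -subr_eq0;
    apply/eqP/Ls.
have [x|b bs [g hg]] := IHs; first by apply/eqP; have := z x; rewrite negbK.
by exists b; [rewrite inE bs orbT | exists g].
Qed.

End Annihilation.

(** The list contains every eigenvalue, but may also contain other numbers: only annihilation is
    required. *)
Definition qucg_spectrum (S : finComUnitRingType) (s : seq algC) : Prop :=
  forall (f : S -> algC) x, poly_op (conv (qucg_set S)) s f x = 0.

Section ConvOperator.
Variable S : finComUnitRingType.
Implicit Types (T : {set S}) (f g : S -> algC).

Lemma conv_shift_op T1 T2 a f :
  conv T1 (shift_op (conv T2) a f) =1 shift_op (conv T2) a (conv T1 f).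
Proof. by move=> x; rewrite /shift_op convB convZ convC. Qed.

Lemma eq_shift_op T a f g : f =1 g ->
  shift_op (conv T) a f =1 shift_op (conv T) a g.
Proof. by move=> fg x; rewrite /shift_op (eq_conv _ fg) fg. Qed.

Lemma eigen_shift_op T1 T2 a b f : (forall x, conv T1 f x = a * f x) ->
  forall x, conv T1 (shift_op (conv T2) b f) x = a * shift_op (conv T2) b f x.
Proof.
move=> fa x; rewrite conv_shift_op (eq_shift_op _ _ fa) /shift_op convZ; ring.
Qed.

(** With [P] the eigenspace of [a], the eigenvector found for some [b] in the list also has
    eigenvalue [a], so they agree. *)
Lemma qucg_eigen_spectrum s a : qucg_spectrum S s -> qucg_eigen S a -> a \in s.
Proof.
move=> Ss [f [f0 fa]].
pose P g := forall x, conv (qucg_set S) g x = a * g x.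
have Ssf := Ss f.
have [b g /(eigen_shift_op (qucg_set S) b)//|//|//|//|b bs [g [Pg [x gx] gb]]]
  :=
  @poly_op_eigen _ (conv (qucg_set S)) P s f.
by rewrite -(mulIf gx (etrans (esym (gb x)) (Pg x))).
Qed.

End ConvOperator.

Section ProductSpectrum.
Variables A B : finComUnitRingType.
Local Notation AB := (A * B)%type.
Hypothesis B_minus1 : (-1 : B) \in unit_squares B.

Lemma unit_squares_pair (x : A) (y : B) :
  (((x, y) : AB) \in unit_squares AB) = (x \in unit_squares A) && (y \in
    unit_squares B).
Proof.
apply/unit_squaresP/andP=> [[[u v] /andP[Uu Uv] [-> ->]]|].
  by split; apply/unit_squaresP; [exists u | exists v].
case=> /unit_squaresP[u Uu ->] /unit_squaresP[v Uv ->].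
by exists (u, v); rewrite //; apply/andP.
Qed.

Lemma unit_squaresN_minus1 (y : B) : (- y \in unit_squares B) = (y \in
  unit_squares B).
Proof.
have N z : z \in unit_squares B -> - z \in unit_squares B.
  by rewrite -mulN1r; apply: unit_squaresM.
by apply/idP/idP=> /N //; rewrite opprK.
Qed.

Lemma qucg_set_squares : qucg_set B = unit_squares B.
Proof. by apply/setP=> y; rewrite mem_qucg_set unit_squaresN_minus1 orbb. Qed.

(** In the product one sign is shared by both components; since -1 is a square in [B], the second
    component absorbs it and the signs become independent. *)
Lemma qucg_set_pair : qucg_set AB = setX (qucg_set A) (qucg_set B).
Proof.
apply/setP=> -[x y]; rewrite in_setX qucg_set_squares !mem_qucg_set.
rewrite -[- (x, y)]/(- x, - y) !unit_squares_pair unit_squaresN_minus1.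
by rewrite andb_orl.
Qed.

Lemma qucg_degree_pair : #|qucg_set AB| = (#|qucg_set A| * #|qucg_set B|)%N.
Proof. by rewrite qucg_set_pair cardsX. Qed.

Lemma conv_setX (X : {set A}) (Y : {set B}) (f : AB -> algC) x y :
  conv (setX X Y) f (x, y) = conv X (fun x' => conv Y (fun y' =>
    f (x', y')) y) x.
Proof.
rewrite /conv pair_big /=; apply: eq_big => [[s t]|[s t] _] //=.
by rewrite in_setX.
Qed.

Lemma conv_set10 (S : finComUnitRingType) (f : S ->
  algC) x : conv [set 0] f x = f x.
Proof. by rewrite /conv big_set1 subr0. Qed.

Lemma poly_op_setX0 (X : {set A}) s (f : AB -> algC) x y :
  poly_op (conv (setX X [set 0])) s f (x, y) = poly_op (conv X) s (fun x' =>
    f (x', y)) x.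
Proof.
elim: s x => //= a s IHs x; rewrite /shift_op conv_setX IHs; congr (_ - _).
by apply: eq_bigr => t _; rewrite conv_set10 IHs.
Qed.

Lemma poly_op_set0X (Y : {set B}) s (f : AB -> algC) x y :
  poly_op (conv (setX [set 0] Y)) s f (x, y) = poly_op (conv Y) s (fun y' =>
    f (x, y')) y.
Proof.
elim: s y => //= a s IHs y; rewrite /shift_op conv_setX conv_set10 IHs.
by congr (_ - _); apply: eq_bigr => t _; rewrite IHs.
Qed.

(** The adjacency operator is the composite of [TA] and [TB], each acting on one coordinate. All
    three commute, so two rounds of [poly_op_eigen] give a common eigenvector. *)
Lemma qucg_eigen_pair sA sB a : qucg_spectrum A sA -> qucg_spectrum B sB ->
  qucg_eigen AB a -> exists b c, [/\ b \in sA, c \in sB & a = b * c].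
Proof.
move=> specA specB [f [f0 fa]].
pose TA := setX (qucg_set A) [set (0 : B)];
  pose TB := setX [set (0 : A)] (qucg_set B).
pose P g := forall x, conv (qucg_set AB) g x = a * g x.
have [c g /(eigen_shift_op TA c)//|//|//|[x y]|b bs [g [Pg g0 gb]]] :=
  @poly_op_eigen _ (conv TA) P sA f.
  by rewrite poly_op_setX0 specA.
pose P' g := P g /\ forall x, conv TA g x = b * g x.
have [c h [hP hb]||//|[x y]|c cs [h [[Ph hb] [z hz] hc]]] :=
  @poly_op_eigen _ (conv TB) P' sB g.
- by split; apply: eigen_shift_op.
- by split.
- by rewrite poly_op_set0X specB.
exists b, c; split=> //; apply: (mulIf hz); rewrite -Ph.
have -> : b * c * h z = conv TA (conv TB h) z.
  by rewrite (eq_conv _ hc) convZ hb; ring.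
case: z {hz} => x y; rewrite qucg_set_pair !conv_setX; apply: eq_bigr => s _.
by rewrite conv_set10 conv_setX conv_set10.
Qed.

End ProductSpectrum.

(** [K] bounds squared moduli, which keeps it a natural number although the eigenvalues may involve
    sqrt q. *)
Definition spectral_gap (S : finComUnitRingType) (K : nat) : Prop :=
  exists2 s, qucg_spectrum S (#|qucg_set S|%:R :: s) &
             {in s, forall a, `|a| ^+ 2 <= K%:R}.

Lemma ramanujan_gap (S : finComUnitRingType) K : spectral_gap S K ->
  (K + 4 <= 4 * #|qucg_set S|)%N -> ramanujan (@qucg S).
Proof.
case=> s spec sK Kr; apply/ramanujanP=> a /(qucg_eigen_spectrum spec).
rewrite inE => /orP[/eqP->|/sK aK _ _]; first by rewrite eqxx.
apply: le_trans aK _.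
by rewrite mulrBr mulr1 lerBrDr -natrD -natrM ler_nat.
Qed.

Lemma ramanujan_gap_pair (A B : finComUnitRingType) KA KB
    (rA := #|qucg_set A|) (rB := #|qucg_set B|) :
  (-1 : B) \in unit_squares B -> spectral_gap A KA -> spectral_gap B KB ->
  (KA <= rA ^ 2)%N ->
  (KA * rB ^ 2 + 4 <= 4 * (rA * rB))%N ->
    (rA ^ 2 * KB + 4 <= 4 * (rA * rB))%N ->
  ramanujan (@qucg (A * B)%type).
Proof.
move=> NB [sA specA sKA] [sB specB sKB] KrA KAr KBr; apply/ramanujanP=> a.
case/(qucg_eigen_pair NB specA specB) => b [c []].
rewrite qucg_degree_pair // natrM -/rA -/rB => bA cB ->.
have le (K : nat) (x : algC) : (K + 4 <= 4 * (rA * rB))%N ->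
    x <= K%:R -> x <= 4 * (rA%:R * rB%:R - 1).
  move=> hK hx; apply: le_trans hx _.
  by rewrite mulrBr mulr1 lerBrDr -!natrM -natrD ler_nat.
rewrite normrM exprMn; move: bA cB; rewrite !inE.
move=> /predU1P[->|/sKA bK] /predU1P[->|/sKB cK]; first by rewrite eqxx.
- move=> _ _; apply: (le _ _ KBr); rewrite natrM normr_nat natrX.
  by rewrite ler_wpM2l // exprn_ge0 ?ler0n.
- move=> _ _; apply: (le _ _ KAr); rewrite natrM normr_nat natrX.
  by rewrite ler_wpM2r // exprn_ge0 ?ler0n.
(* Both eigenvalues nontrivial: as KA <= rA^2, the bound for rA times the second one applies. *)
move=> _ _; apply: (le _ _ KBr); rewrite natrM.
by rewrite ler_pM ?exprn_ge0 // (le_trans bK) // ler_nat.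
Qed.

(** * Eigenvalue bounds for local rings and fields, and the Ramanujan families *)

Section LocalGap.
Variable S : finComUnitRingType.
Hypothesis localS : is_local S.
Local Notation M := (nonunits S).
Local Notation m := #|M|.
Local Notation q := (#|S| %/ m)%N.
Local Notation L := (conv (qucg_set S)).

Lemma conv_nonunitsD (f : S -> algC) x y : y \in M ->
  conv M f (x + y) = conv M f x.
Proof.
move=> My; rewrite /conv (reindex_inj (addIr y)) /=.
apply: eq_big => [t|t _]; first by rewrite nonunitsD.
by congr f; ring.
Qed.

(* The first operator of the list kills the constants. *)
Lemma spectrum_const s :
  (forall f : S -> algC, exists c, forall x, poly_op L s f x = c) ->
  qucg_spectrum S (#|qucg_set S|%:R :: s).
Proof.
move=> sc f x; have [c fc] := sc f.
by rewrite /= /shift_op (eq_conv _ fc) conv_const fc subrr.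
Qed.

(** The operator L is the total sum minus [conv M], and [conv M] squares to m times itself; so (L +
    m) L maps every function to a constant. *)
Lemma local_gap3 : (q %% 4 = 3)%N -> spectral_gap S (m ^ 2).
Proof.
move=> q3; exists [:: - m%:R; 0]; last first.
  move=> a; rewrite !inE => /orP[]/eqP->;
    first by rewrite normrN normr_nat natrX.
  by rewrite normr0 expr0n /= ler0n.
apply: spectrum_const => f; pose g := shift_op L 0 f.
have gE x : g x = \sum_t f t - conv M f x.
  by rewrite /g /shift_op mul0r subr0 qucg_set3 // conv_units.
exists (\sum_t g t) => x; rewrite [LHS]/shift_op -/g qucg_set3 // conv_units.
rewrite (eq_conv _ gE) convB conv_const conv_nonunits // => [|y My]; last first.
  exact: conv_nonunitsD.
by rewrite gE; ring.
Qed.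

Lemma qchar_op_sqr (f : S -> algC) x : (q %% 4 = 1)%N ->
  \sum_t qchar t * \sum_u qchar u * f (x - t - u) =
  m%:R * (q%:R * conv M f x - \sum_t f t).
Proof.
move=> q1; under eq_bigr => t _.
  rewrite (reindex_inj (addIr (- t))) mulr_sumr /=.
  under eq_bigr do rewrite opprB addrA subrK mulrA; over.
rewrite exchange_big /=; under eq_bigr do rewrite -mulr_suml qchar_convolution
  //.
rewrite [\sum_t f t](reindex_inj (inj_comp (addrI x) oppr_inj)) /=.
rewrite /conv -sum_nonunits mulr_sumr -sumrB mulr_sumr.
by apply: eq_bigr => t _; ring.
Qed.

(** Modulo constants, convolution with [qchar] squares to q, which leaves (-1 +- sqrt q)/2 besides
    the degree. Their squares are at most (q + 1)/2, the degree plus one. *)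
Lemma field_gap1 : m = 1%N -> (q %% 4 = 1)%N -> spectral_gap S #|qucg_set S|.+1.
Proof.
move=> m1 q1; pose w : algC := sqrtC q%:R; have w2 : w ^+ 2 = q%:R := sqrtCK _.
have w0 : 0 <= w by rewrite sqrtC_ge0.
have m1R : m%:R = 1 :> algC by rewrite m1.
have M0 : M = [set 0].
  by apply/eqP; rewrite eq_sym eqEcard sub1set nonunits0 cards1 m1.
have convM (f : S -> algC) x : conv M f x = f x by rewrite M0 conv_set10.
have LE f x : L f x = (\sum_t f t - f x + \sum_t qchar t * f (x - t)) / 2.
  by rewrite qucg_set1 // conv_squares // convM.
exists [:: (-1 + w) / 2; (-1 - w) / 2].
  apply: spectrum_const => f; pose g := shift_op L ((-1 - w) / 2) f.
  have gE x : g x = (\sum_t f t + \sum_t qchar t * f (x - t) + w * f x) / 2.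
    by rewrite /g /shift_op LE; field.
  (* The remaining factor maps g to half of: its total sum, plus its convolution with [qchar], minus
     w g. The last two differ only by a multiple of the total sum of f. *)
  exists ((\sum_t g t - (1 + w) / 2 * \sum_t f t) / 2) => x.
  rewrite [LHS]/shift_op -/g LE.
  have -> : \sum_t qchar t * g (x - t) =
      (q%:R * f x - \sum_t f t + w * \sum_t qchar t * f (x - t)) / 2.
    have := qchar_op_sqr f x q1; rewrite m1R mul1r convM => <-.
    transitivity ((\sum_(t : S) qchar t * (\sum_u f u) +
        \sum_t qchar t * (\sum_u qchar u * f (x - t - u)) +
        w * (\sum_t qchar t * f (x - t))) / 2).
      rewrite [w * _]mulr_sumr -!big_split /= mulr_suml; apply: eq_bigr => t _.
      by rewrite gE; field.
    by rewrite -mulr_suml sum_qchar // mul0r add0r.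
  by rewrite gE -w2; field.
have nb (e : algC) : e = 1 \/ e = -1 ->
  `|(-1 + e * w) / 2| ^+ 2 <= (q%:R + 1) / 2.
  move=> he; have eR : e * w \is Num.real by case: he => ->;
    rewrite ?mulN1r ?mul1r ?rpredN ger0_real.
  have e2 : (e * w) ^+ 2 = q%:R by rewrite -w2; case: he => ->; ring.
  rewrite real_normK; last by rewrite rpredM ?rpredD ?rpredN ?rpredV ?real1
    ?realn.
  rewrite -subr_ge0 -e2.
  have -> : ((e * w) ^+ 2 + 1) / 2 - ((-1 + e * w) / 2) ^+ 2 = ((1 + e * w) /
    2) ^+ 2.
    by field.
  by rewrite real_exprn_even_ge0 // rpredM ?rpredD ?rpredV ?real1 ?realn.
have -> : #|qucg_set S|.+1%:R = (q%:R + 1) / 2 :> algC.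
  apply: (canRL (mulfK _)); rewrite ?pnatr_eq0 // natr1 -natrM; congr _%:R.
  rewrite mulSn qucg_degree1 // [X in (_ * X)%N]m1 muln1 add2n prednK //.
  exact/odd_gt0/residue_odd1.
move=> a; rewrite !inE => /orP[]/eqP->.
  by rewrite -[w]mul1r nb //; left.
by rewrite -[- w]mulN1r nb //; right.
Qed.

End LocalGap.

Section FieldFacts.
Variable F : finFieldType.

Lemma nonunits_field : nonunits F = [set 0].
Proof. by apply/setP=> x; rewrite !inE unitfE negbK. Qed.

Lemma is_local_field : is_local F.
Proof. by move=> x y; rewrite nonunits_field !inE => /eqP-> /eqP->;
  rewrite addr0. Qed.

Lemma card_nonunits_field : #|nonunits F| = 1%N.
Proof. by rewrite nonunits_field cards1. Qed.

Lemma residue_field : (#|F| %/ #|nonunits F|)%N = #|F|.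
Proof. by rewrite card_nonunits_field divn1. Qed.

Lemma field_prime_power : prime_power #|F|.
Proof.
have [p pr_p pF] := finPcharP F.
have := abelem_pgroup (fin_ring_pchar_abelem pF).
rewrite /pgroup cardsT => /p_natP[k Fk]; exists p, k; split=> //.
by case: k Fk => // F1; have := finNzRing_gt1 F; rewrite [#|_|]F1.
Qed.

Lemma field_degree1 : (#|F| %% 4 = 1)%N -> (#|qucg_set F| * 2 = #|F|.-1)%N.
Proof.
move=> F1; rewrite (qucg_degree1 is_local_field) ?residue_field //.
by rewrite card_nonunits_field muln1.
Qed.

Lemma field_degree3 : (#|F| %% 4 = 3)%N -> (#|qucg_set F| = #|F|.-1)%N.
Proof.
move=> F3; rewrite (qucg_degree3 is_local_field) ?residue_field //.
by rewrite card_nonunits_field muln1.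
Qed.

Lemma field_minus1_square : (#|F| %% 4 = 1)%N -> (-1 : F) \in unit_squares F.
Proof. by move=> F1; apply: minus1_square1 is_local_field _;
  rewrite residue_field. Qed.

Lemma field_gap_paley : (#|F| %% 4 = 1)%N -> spectral_gap F #|qucg_set F|.+1.
Proof.
move=> F1; have := field_gap1 is_local_field card_nonunits_field.
by rewrite residue_field; apply.
Qed.

Lemma field_gap_complete : (#|F| %% 4 = 3)%N -> spectral_gap F 1.
Proof.
move=> F3; have := local_gap3 is_local_field.
by rewrite residue_field card_nonunits_field exp1n; apply.
Qed.

End FieldFacts.

Lemma ramanujan_field (F : finFieldType) :
  (#|F| %% 4 = 1)%N -> ramanujan (@qucg F).
Proof.
move=> F1; apply: ramanujan_gap (field_gap_paley F1) _.
have : (1 < #|F|)%N := finNzRing_gt1 F.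
by have := field_degree1 F1; lia.
Qed.

(** Both degrees are 2 and both gaps 3, so the criterion 3 * 4 + 4 <= 16 holds with equality. *)
Lemma ramanujan_field_pair5 (F1 F2 : finFieldType) :
  #|F1| = 5%N -> #|F2| = 5%N -> ramanujan (@qucg (F1 * F2)%type).
Proof.
move=> c1 c2; have m1 : (#|F1| %% 4 = 1)%N by rewrite c1.
have m2 : (#|F2| %% 4 = 1)%N by rewrite c2.
have d1 : #|qucg_set F1| = 2%N by have := field_degree1 m1; rewrite c1; lia.
have d2 : #|qucg_set F2| = 2%N by have := field_degree1 m2; rewrite c2; lia.
apply: (ramanujan_gap_pair (field_minus1_square m2) (field_gap_paley m1)
  (field_gap_paley m2)); by rewrite d1 ?d2.
Qed.

(** For degrees 2 and d the criterion reads d^2 + 4 <= 8 d and 4 (d + 1) + 4 <= 8 d. It holds for d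
    = 2, 4, 6; the first part fails at d = 8, the field of order 17. *)
Lemma ramanujan_field_pair3 (F1 F2 : finFieldType) :
  #|F1| = 3%N -> #|F2| \in [:: 5; 9; 13]%N -> ramanujan (@qucg (F1 * F2)%type).
Proof.
move=> c1 c2; have m1 : (#|F1| %% 4 = 3)%N by rewrite c1.
have m2 : (#|F2| %% 4 = 1)%N by move: c2; rewrite !inE => /or3P[]/eqP->.
have d1 : #|qucg_set F1| = 2%N by rewrite (field_degree3 m1) c1.
have d2 : #|qucg_set F2| \in [:: 2; 4; 6]%N.
  have := field_degree1 m2; move: c2; rewrite !inE => /or3P[]/eqP->; lia.
apply: (ramanujan_gap_pair (field_minus1_square m2) (field_gap_complete m1)
  (field_gap_paley m2)); by rewrite d1 //; move: d2;
    rewrite !inE => /or3P[]/eqP->.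
Qed.

(** * Ring isomorphisms and products of families *)

Lemma ring_iso_trans (A B C : nzRingType) : ring_iso A B -> ring_iso B C ->
  ring_iso A C.
Proof.
by move=> [f bf] [g bg]; exists (g \o f : {rmorphism A -> C}); apply: bij_comp.
Qed.

(** If 0 is the only nonunit, [S] is a field; the structure is packed on the same carrier, so the
    isomorphism is the identity. *)
Lemma field_of_nonunits (S : finComUnitRingType) : #|nonunits S| = 1%N ->
  exists F : finFieldType, #|F| = #|S| /\ ring_iso S F.
Proof.
move=> m1; have M0 : nonunits S = [set 0].
  by apply/eqP; rewrite eq_sym eqEcard sub1set nonunits0 cards1 m1.
have fS : GRing.field_axiom S.
  move=> x x0; apply: contraNT x0 => Ux; have : x \in nonunits S by rewrite inE.
  by rewrite M0 inE.
pose F : finFieldType := HB.pack_for finFieldType S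
  (GRing.ComUnitRing_isField.Build S fS).
exists F; split=> //; exists (idfun : {rmorphism S -> F}).
by exists id.
Qed.

Section PairIso.
Variables A B C D : nzRingType.
Variables (f : {rmorphism A -> C}) (g : {rmorphism B -> D}).

Definition pair_map (z : A * B) : C * D := (f z.1, g z.2).

Fact pair_map_additive : zmod_morphism pair_map.
Proof. by move=> x y; rewrite /pair_map !rmorphB. Qed.
Fact pair_map_multiplicative : monoid_morphism pair_map.
Proof. by split=> [|x y]; rewrite /pair_map ?rmorph1 ?rmorphM. Qed.

HB.instance Definition _ :=
  GRing.isZmodMorphism.Build (A * B)%type (C * D)%type pair_map
    pair_map_additive.
HB.instance Definition _ :=
  GRing.isMonoidMorphism.Build (A * B)%type (C * D)%type pair_map
    pair_map_multiplicative.

Lemma pair_map_bij : bijective f -> bijective g -> bijective pair_map.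
Proof.
case=> f' fK f'K [g' gK g'K]; exists (fun z => (f' z.1, g' z.2)) => -[x y].
  by rewrite /= fK gK.
by rewrite /pair_map /= f'K g'K.
Qed.

End PairIso.

Lemma ring_iso_pair (A B C D : nzRingType) :
  ring_iso A C -> ring_iso B D -> ring_iso (A * B)%type (C * D)%type.
Proof.
move=> [f bf] [g bg]; exists (pair_map f g : {rmorphism _ -> _}).
exact: pair_map_bij.
Qed.

Section ProdRingFacts.
Variables (s : nat) (R : 'I_s.+1 -> finComUnitRingType).
Local Notation P := (prodring R).
Implicit Types f g : P.

Lemma prod1E i : (1 : P) i = 1.
Proof. exact: ffunE. Qed.
Lemma prodNE f i : (- f) i = - f i.
Proof. exact: ffunE. Qed.
Lemma prodDE f g i : (f + g) i = f i + g i.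
Proof. exact: ffunE. Qed.
Lemma prodME f g i : (f * g) i = f i * g i.
Proof. exact: ffunE. Qed.

Definition pr_proj i f : R i := f i.

Fact pr_proj_additive i : zmod_morphism (pr_proj i).
Proof. by move=> f g; rewrite /pr_proj prodDE prodNE. Qed.
Fact pr_proj_multiplicative i : monoid_morphism (pr_proj i).
Proof. by split=> [|f g]; rewrite /pr_proj ?prod1E ?prodME. Qed.

HB.instance Definition _ i :=
  GRing.isZmodMorphism.Build P (R i) (pr_proj i) (pr_proj_additive i).
HB.instance Definition _ i :=
  GRing.isMonoidMorphism.Build P (R i) (pr_proj i) (pr_proj_multiplicative i).

Lemma prodring_unitE f : (f \is a GRing.unit) = [forall i, f i \is a
  GRing.unit].
Proof. by []. Qed.

Lemma unit_lifting_proj i : unit_lifting (pr_proj i).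
Proof.
move=> u Uu; exists ([ffun j => dfwith (fun k => 1 : R k) u j] : P).
  rewrite prodring_unitE; apply/forallP=> j; rewrite ffunE.
  by case: dfwithP => // k _; rewrite unitr1.
by rewrite /= /pr_proj ffunE dfwith_in.
Qed.

Lemma unit_squares_prodring f :
  (f \in unit_squares P) = [forall i, f i \in unit_squares (R i)].
Proof.
apply/unit_squaresP/forallP=> [[u Uu ->] i|sq].
  by apply/unit_squaresP; exists (u i);
    [exact: (forallP Uu) | rewrite expr2 prodME].
(* A square root is chosen in each component; the default 1 is never reached, by [sq]. *)
pose u i := odflt 1 [pick v : R i | (v \is a GRing.unit) && (v ^+ 2 == f i)].
have uP i : (u i \is a GRing.unit) && (u i ^+ 2 == f i).
  rewrite /u; case: pickP => //= no; have /unit_squaresP[v Uv e] := sq i.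
  by have := no v; rewrite Uv e eqxx.
exists ([ffun i => u i] : P).
  by rewrite prodring_unitE; apply/forallP=> i; rewrite ffunE;
    case/andP: (uP i).
by apply/ffunP=> i; rewrite expr2 prodME !ffunE -expr2;
  case/andP: (uP i) => _ /eqP.
Qed.

Lemma card_unit_squares_prodring :
  #|unit_squares P| = (\prod_i #|unit_squares (R i)|)%N.
Proof.
rewrite -cardsXn; apply: eq_card => f; rewrite unit_squares_prodring in_setXn.
by [].
Qed.

Lemma prodring_minus1_square :
  (forall i, (-1 : R i) \in unit_squares (R i)) -> (-1 : P) \in unit_squares P.
Proof.
move=> h; rewrite unit_squares_prodring; apply/forallP=> i.
by rewrite prodNE prod1E.
Qed.

End ProdRingFacts.

Lemma ring_iso_prodring1 (R : 'I_1 -> finComUnitRingType) :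
  ring_iso (prodring R) (R ord0).
Proof.
exists (pr_proj ord0 : {rmorphism prodring R -> R ord0}).
exists (fun x => [ffun j => dfwith (fun k => 1 : R k) x j] : prodring R).
  by move=> f; apply/ffunP=> j; rewrite ffunE (ord1 j) dfwith_in.
by move=> x; rewrite /= /pr_proj ffunE dfwith_in.
Qed.

Section ProdRing2.
Variable R : 'I_2 -> finComUnitRingType.
Let i1 : 'I_2 := lift ord0 ord0.

Definition pr_pair (f : prodring R) : R ord0 * R i1 := (f ord0, f i1).

Fact pr_pair_additive : zmod_morphism pr_pair.
Proof. by move=> f g; rewrite /pr_pair !prodDE !prodNE. Qed.
Fact pr_pair_multiplicative : monoid_morphism pr_pair.
Proof. by split=> [|f g]; rewrite /pr_pair ?prod1E ?prodME. Qed.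

HB.instance Definition _ := GRing.isZmodMorphism.Build
  (prodring R) (R ord0 * R i1)%type pr_pair pr_pair_additive.
HB.instance Definition _ := GRing.isMonoidMorphism.Build
  (prodring R) (R ord0 * R i1)%type pr_pair pr_pair_multiplicative.

Lemma ring_iso_prodring2 : ring_iso (prodring R) (R ord0 * R i1)%type.
Proof.
exists (pr_pair : {rmorphism _ -> _}).
pose z0 := fun k => 1 : R k.
exists (fun x => [ffun j => dfwith (dfwith z0 x.1) x.2 j] : prodring R) =>
  [f|[x y]].
  apply/ffunP=> j; rewrite ffunE; case: (unliftP ord0 j) => [k ->|->].
    by rewrite (ord1 k) dfwith_in.
  by rewrite dfwith_out // dfwith_in.
by rewrite /= /pr_pair !ffunE dfwith_in dfwith_out ?dfwith_in.
Qed.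

End ProdRing2.

(* The condition r < 4 (sqrt q - 1)^2, that is 8 sqrt q < 4 q + 4 - r. *)
Definition small_degree (q r : nat) : Prop :=
  (r < 4 * q + 4)%N /\ (64 * q < (4 * q + 4 - r) ^ 2)%N.

(** * Degree bounds forced by a local quotient of a Ramanujan ring *)

Section QuotientBound.
Variables (S S' : finComUnitRingType) (pi : {rmorphism S -> S'}).
Hypotheses (pi_lift : unit_lifting pi) (localS' : is_local S').
Hypothesis ramS : ramanujan (@qucg S).
Local Notation r := #|qucg_set S|.
Local Notation m := #|nonunits S'|.
Local Notation q := (#|S'| %/ m)%N.

Lemma residue_gt1 : (1 < q)%N.
Proof.
have := card_units localS'; have : (0 < #|[set u : S' | u \is a GRing.unit]|)%N.
  by apply/card_gt0P; exists 1; rewrite inE unitr1.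
by move=> + U; rewrite U muln_gt0 => /andP[]; case: (q) => [|[]].
Qed.

(** With c = m (1 + w)/2 the quotient has degree c (w - 1) and eigenvalue -c. Dividing the lifted
    inequality by c^2 gives r^2 <= 4 (r - 1) (w - 1)^2, hence r < 4 (w - 1)^2. *)
Lemma ramanujan_quotient1 : (q %% 4 = 1)%N -> small_degree q r.
Proof.
move=> q1; pose w : algC := sqrtC q%:R; have w2 : w ^+ 2 = q%:R := sqrtCK _.
have q5 : (4 < q)%N by move: q1 residue_gt1; case: (q) => [|[|[|[|[|]]]]].
have w0 : 0 <= w by rewrite sqrtC_ge0.
(* From q >= 5. It makes c smaller than c (w - 1), so -c is a nontrivial eigenvalue. *)
have wgt2 : 2 < w.
  by rewrite -(ltr_pXn2r (_ : 0 < 2)%N) ?nnegrE // w2 -natrX ltr_nat.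
have m0 : 0 < m%:R :> algC by rewrite ltr0n card_nonunits_gt0.
have r0 : 0 < r%:R :> algC by rewrite ltr0n qucg_degree_gt0.
have w1 : 0 < 1 + w by rewrite ltr_wpDr.
pose c : algC := m%:R * (1 + w) / 2.
have c0 : 0 < c by rewrite divr_gt0 // mulr_gt0.
have tE : #|qucg_set S'|%:R = c * (w - 1).
  apply: (mulIf (_ : 2 != 0)); rewrite ?pnatr_eq0 // -natrM qucg_degree1 //.
  have -> : c * (w - 1) * 2 = (w ^+ 2 - 1) * m%:R by rewrite /c; field.
  by rewrite w2 natrM -subn1 natrB // ltnW ?residue_gt1.
have := ramanujan_lift pi_lift ramS (qucg_eigen1 localS' q1).
rewrite -/w -/c normrN (gtr0_norm c0) tE.
have cw : c < c * (w - 1) by rewrite ltr_pMr // ltrBrDr.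
have n1 : - c != c * (w - 1).
  by rewrite lt_eqF // (lt_trans _ (lt_trans c0 cw)) ?oppr_lt0.
have n2 : - c != - (c * (w - 1)) by rewrite eqr_opp lt_eqF.
move=> /(_ n1 n2); rewrite [(c * r%:R) ^+ 2]exprMn [(c * (w - 1)) ^+ 2]exprMn
  [leRHS]mulrCA.
rewrite ler_pM2l ?exprn_gt0 // => le1.
have z0 : 0 < (w - 1) ^+ 2
  by rewrite exprn_gt0 // subr_gt0 (lt_trans _ wgt2) ?ltr1n.
have : r%:R * r%:R < r%:R * (4 * (w - 1) ^+ 2).
  rewrite -expr2; apply: le_lt_trans le1 _.
  by rewrite mulrA ltr_pM2r // mulrC ltr_pM2r ?ltr0n // ltrBlDr ltrDl.
rewrite ltr_pM2l //.
have -> : 4 * (w - 1) ^+ 2 = (4 * q + 4)%N%:R - 8 * w.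
  by rewrite natrD natrM -w2; ring.
rewrite ltrBrDr => lt8.
have lt1 : (r < 4 * q + 4)%N.
  by rewrite -(ltr_nat algC); apply: le_lt_trans lt8; rewrite lerDl mulr_ge0.
split=> //; rewrite -(ltr_nat algC) natrX natrM -w2 (natrB _ (ltnW lt1)).
have -> : 64%:R * w ^+ 2 = (8 * w) ^+ 2 by ring.
have ltw : 8 * w < (4 * q + 4)%N%:R - r%:R by rewrite ltrBrDr addrC.
by rewrite ltr_pXn2r // nnegrE ?mulr_ge0 // (le_trans _ (ltW ltw)) ?mulr_ge0.
Qed.

Lemma ramanujan_quotient3 : (q %% 4 = 3)%N -> (r < 4 * q.-1 ^ 2)%N.
Proof.
move=> q3; have m0 : 0 < m%:R :> algC by rewrite ltr0n card_nonunits_gt0.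
have r0 : 0 < r%:R :> algC by rewrite ltr0n qucg_degree_gt0.
have := ramanujan_lift pi_lift ramS (qucg_eigen3 localS' q3).
rewrite normrN normr_nat qucg_degree3 // natrM.
have q2 : 1 < q.-1%:R :> algC.
  by rewrite ltr1n; move: q3 residue_gt1; case: (q) => [|[|[|]]].
have mq : m%:R < q.-1%:R * m%:R :> algC by rewrite ltr_pMl.
have n1 : - m%:R != q.-1%:R * m%:R :> algC.
  by rewrite lt_eqF // (lt_trans _ (lt_trans m0 mq)) ?oppr_lt0.
have n2 : - m%:R != - (q.-1%:R * m%:R) :> algC by rewrite eqr_opp lt_eqF.
move=> /(_ n1 n2); rewrite [q.-1%:R * _]mulrC !exprMn [leRHS]mulrCA ler_pM2l
  ?exprn_gt0 // => le1.
have z0 : 0 < q.-1%:R ^+ 2 :> algC by rewrite exprn_gt0 // (lt_trans _ q2).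
have : r%:R * r%:R < r%:R * (4 * q.-1%:R ^+ 2) :> algC.
  rewrite -expr2; apply: le_lt_trans le1 _.
  by rewrite mulrA ltr_pM2r // mulrC ltr_pM2r ?ltr0n // ltrBlDr ltrDl.
by rewrite ltr_pM2l // -natrX -natrM ltr_nat.
Qed.

End QuotientBound.

(** * Numerical consequences of the degree bounds *)

Lemma small_degree_le q r r' : (r' <= r)%N -> small_degree q r ->
  small_degree q r'.
Proof.
move=> rr [lt1 lt2]; split; first exact: leq_ltn_trans lt1.
by apply: leq_trans lt2 _; rewrite leq_exp2r // leq_sub2l.
Qed.

(** Write q = 4 k + 1. If m >= q then n >= 2 k (4 k + 1); the linear half of [small_degree] leaves k
    <= 2, and the quadratic half excludes k = 1 and k = 2. *)
Lemma small_degree_local q m n : (q %% 4 = 1)%N -> (1 < q)%N ->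
  (0 < m)%N -> ((1 < m) -> (q <= m))%N -> (n * 2 = q.-1 * m)%N ->
  small_degree q n -> m = 1%N.
Proof.
move=> q1 q_gt1 m0 mq nE sd; apply/eqP; rewrite eqn_leq m0 andbT leqNgt.
apply/negP=> /mq {}mq; have [k qk] : exists k, q = (4 * k + 1)%N
  by exists (q %/ 4)%N; lia.
have nm : n = (2 * k * m)%N by rewrite qk in nE; lia.
have le_n : (2 * k * (4 * k + 1) <= n)%N by rewrite nm leq_mul // -qk.
case: (small_degree_le le_n sd); rewrite qk => lt1 lt2;
  have k2 : (k <= 2)%N by nia.
by move: k2 lt2 q_gt1; rewrite qk; case: (k) => [|[|[|]]].
Qed.

(** The last clause serves products of three or more factors, where the remaining factors at least
    double the degree. *)
Lemma small_degree_two q q' m m' n n' : (q %% 4 = 1)%N -> (1 < q)%N ->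
  (0 < m)%N -> (0 < m')%N -> ((1 < m) -> (q <= m))%N -> ((1 < m') ->
    (q' <= m'))%N ->
  (q <= q')%N -> (n * 2 = q.-1 * m)%N -> (n' * 2 = q'.-1 * m')%N ->
  (q' %% 4 = 1)%N ->
  small_degree q (n * n') ->
  [/\ q = 5, m = 1, q' = 5 & m' = 1]%N /\ ~ small_degree q (n * n' * 2).
Proof.
move=> q1 q_gt1 m0 m0' mq mq' qq' nE nE' q1' sd;
  have [k qk] : exists k, q = (4 * k + 1)%N by exists (q %/ 4)%N; lia.
have [k' qk'] : exists k, q' = (4 * k + 1)%N by exists (q' %/ 4)%N; lia.
have nm : n = (2 * k * m)%N by rewrite qk in nE; lia.
have nm' : n' = (2 * k' * m')%N by rewrite qk' in nE'; lia.
have kk : (k <= k')%N by lia.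
have k0 : (0 < k)%N by lia.
have nk : (2 * k <= n)%N by rewrite nm leq_pmulr.
have nk' : (2 * k <= n')%N by rewrite nm' (leq_trans _ (leq_pmulr _ m0')) //;
  lia.
have le_n := leq_mul nk nk'.
have [lt1 lt2] := small_degree_le le_n sd.
(* From 4 k^2 < 16 k + 8. Of the remaining values only k = 1 passes the quadratic half; k = 2 fails
   because 576 < 576 is false. *)
have kle : (k <= 4)%N.
  rewrite leqNgt; apply/negP=> k5; have := leq_mul k5 (leqnn k).
  by rewrite qk in lt1; lia.
have k1 : k = 1%N.
  by move: kle k0 lt2; rewrite qk; case: (k) => [|[|[|[|[|]]]]].
(* For q = 5 the quadratic half is 320 < (24 - x)^2, true at x = 6 (324) and false at x = 7
   (289). *)
have n6 : (n * n' <= 6)%N.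
  case: sd => _; rewrite qk k1 => lt3; rewrite leqNgt; apply/negP=> n7.
  have : ((4 * (4 * 1 + 1) + 4 - n * n') ^ 2 <= 17 ^ 2)%N
    by rewrite leq_exp2r // leq_subLR; lia.
  by move=> h; have := leq_trans lt3 h.
have [mE mE' kE'] : [/\ m = 1, m' = 1 & k' = 1]%N.
  by rewrite k1 in nm; rewrite nm nm' in n6; split; nia.
split; first by split; lia.
by case=> _; rewrite nm nm' qk k1 mE mE' kE'.
Qed.

(** The degree is at least 8 k^2 with q = 4 k + 1. The linear half gives k <= 2, and the quadratic
    half rejects both values. *)
Lemma small_degree_mixed2 q q' m m' K n n' : (q %% 4 = 1)%N -> (1 < q)%N ->
  (0 < m)%N -> (0 < m')%N -> (1 < K)%N ->
  (q <= q')%N -> (n * 2 = q.-1 * m)%N -> (n' * 2 = q'.-1 * m')%N ->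
  (q' %% 4 = 1)%N ->
  ~ small_degree q (K * (n * n')).
Proof.
move=> q1 q_gt1 m0 m0' K1 qq' nE nE' q1' sd;
  have [k qk] : exists k, q = (4 * k + 1)%N by exists (q %/ 4)%N; lia.
have [k' qk'] : exists k, q' = (4 * k + 1)%N by exists (q' %/ 4)%N; lia.
have nm : n = (2 * k * m)%N by rewrite qk in nE; lia.
have nm' : n' = (2 * k' * m')%N by rewrite qk' in nE'; lia.
have kk : (k <= k')%N by lia.
have k0 : (0 < k)%N by lia.
have nk : (2 * k <= n)%N by rewrite nm leq_pmulr.
have nk' : (2 * k <= n')%N by rewrite nm' (leq_trans _ (leq_pmulr _ m0')) //;
  lia.
have le_n := leq_mul K1 (leq_mul nk nk').
have [lt1 lt2] := small_degree_le le_n sd.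
have kle : (k <= 2)%N.
  rewrite leqNgt; apply/negP=> k3; have := leq_mul k3 (leqnn k).
  by rewrite qk in lt1; lia.
by move: kle k0 lt2; rewrite qk; case: (k) => [|[|[|]]].
Qed.

Lemma small_degree_mixed q q0 m m0 n : (q %% 4 = 1)%N -> (1 < q)%N ->
  (q0 %% 4 = 3)%N -> (0 < m0)%N -> ((1 < m0) -> (q0 <= m0))%N ->
  (0 < m)%N -> ((1 < m) -> (q <= m))%N -> (n * 2 = q.-1 * m)%N ->
  (q0.-1 * m0 * n < 4 * q0.-1 ^ 2)%N ->
  small_degree q (q0.-1 * m0 * n) ->
  [/\ q0 = 3, m0 = 1, m = 1 & q \in [:: 5; 9; 13]]%N.
Proof.
move=> q1 q_gt1 q03 m00 mq0 mp mq nE lt0 sd;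
  have [k qk] : exists k, q = (4 * k + 1)%N by exists (q %/ 4)%N; lia.
have [j qj] : exists j, q0 = (4 * j + 3)%N by exists (q0 %/ 4)%N; lia.
have K0 : (0 < q0.-1 * m0)%N by rewrite qj; nia.
have m1 : m = 1%N.
  apply: (small_degree_local q1 q_gt1 mp mq nE).
  by apply: small_degree_le sd; rewrite leq_pmull.
have nk : n = (2 * k)%N by rewrite m1 qk in nE; lia.
have k0 : (0 < k)%N by lia.
(* If the first factor has degree at least 8, the total is at least 16 k, so 4 q + 4 minus it is at
   most 8, whose square is below 64 q. *)
have [K8|K8] := leqP 8 (q0.-1 * m0).
  have le_n : (16 * k <= q0.-1 * m0 * n)%N by rewrite nk; nia.
  by have [lt1] := small_degree_le le_n sd; rewrite qk; nia.
have [[j0 m01]|K6] : (j = 0 /\ m0 = 1 \/ q0.-1 * m0 = 6 /\ (j <= 1))%N.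
  rewrite qj in K8 mq0 *; have j1 : (j <= 1)%N by nia.
  by move: j1 K8 mq0; case: (j) => [|[|//]] _; lia.
  (* For q0 = 3 and m0 = 1 the bound [lt0] is 4 k < 16. *)
  have k3 : (k <= 3)%N by move: lt0; rewrite nk qj j0 m01; lia.
  split; rewrite ?qj ?j0 // qk.
  by move: k3 k0; case: (k) => [|[|[|[|]]]].
(* With first degree 6, the bound [lt0] gives 12 k < 144, while the quadratic half amounts to 12 k <
   k^2. *)
case: K6 => K6 j1; exfalso; move: lt0 sd; rewrite K6 nk => lt0 [_].
have k12 : (k < 12)%N by move: lt0; rewrite qj; nia.
by rewrite qk; nia.
Qed.

(** * Classification of the Ramanujan graphs in the three cases *)

Lemma ramanujan_local3 (S : finComUnitRingType) (m := #|nonunits S|) :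
  is_local S -> (#|S| %/ m %% 4 = 3)%N ->
  ramanujan (@qucg S) <-> ((m + 2) ^ 2 <= 4 * #|S|)%N.
Proof.
move=> locS q3; have q_gt1 := residue_gt1 locS.
have rE := qucg_degree3 locS q3; rewrite -/m in rE q_gt1.
have m_gt0 : (0 < m)%N := card_nonunits_gt0 S.
(* As |S| is the degree plus m, the two inequalities differ by 4 m on both sides. *)
have -> : ((m + 2) ^ 2 <= 4 * #|S|)%N = (m ^ 2 + 4 <= 4 * #|qucg_set S|)%N.
  have aux k l : (1 < l)%N -> ((k + 2) ^ 2 <= 4 * (l * k))%N = (k ^ 2 + 4 <= 4
    * (l.-1 * k))%N.
    by case: l => // l _; rewrite !expnS !expn0 mulSn /=; apply/idP/idP; lia.
  by rewrite rE -aux // -card_local.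
split=> [/ramanujanP h|]; last exact/ramanujan_gap/local_gap3.
have m0 : 0 < m%:R :> algC by rewrite ltr0n.
have r_gt_m : m%:R < #|qucg_set S|%:R :> algC.
  rewrite ltr_nat rE ltn_Pmull //.
  by move: q3 q_gt1; case: (#|S| %/ m)%N => [|[|[|]]].
have := h _ (qucg_eigen3 locS q3); rewrite -/m normrN normr_nat eqr_opp.
rewrite (lt_eqF r_gt_m) lt_eqF; last first.
  by rewrite (lt_trans _ (lt_trans m0 r_gt_m)) ?oppr_lt0.
by move=> /(_ isT isT); rewrite mulrBr mulr1 lerBrDr -natrX -natrM -natrD
  ler_nat.
Qed.

Section LocalProduct.
Variables (s : nat) (R : 'I_s.+1 -> finComUnitRingType).
Hypothesis localR : forall i, is_local (R i).
Local Notation m i := #|nonunits (R i)|.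
Local Notation q i := (#|R i| %/ m i)%N.
Local Notation n i := #|unit_squares (R i)|.
Hypothesis q1 : forall i, (q i %% 4 = 1)%N.

Lemma local_prod_minus1 : (-1 : prodring R) \in unit_squares (prodring R).
Proof. by apply: prodring_minus1_square => i; apply: minus1_square1. Qed.

Lemma local_prod_degree : #|qucg_set (prodring R)| = (\prod_i n i)%N.
Proof. by rewrite qucg_set_squares ?local_prod_minus1 //
  card_unit_squares_prodring. Qed.

Lemma local_squares i : (n i * 2 = (q i).-1 * m i)%N.
Proof. by rewrite -(qucg_degree1 (@localR i) (q1 i)) qucg_set1. Qed.

Lemma local_squares_gt1 i : (1 < n i)%N.
Proof.
have := local_squares i; have := residue_gt1 (@localR i); have := q1 i.
have := card_nonunits_gt0 (R i); move: (m i) (q i) (n i) => a b c; nia.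
Qed.

End LocalProduct.

(** The quotient bound is applied to the first factor, whose residue field is smallest; the cases
    are one factor, two factors, and more. *)
Lemma ramanujan_local_prod s (R : 'I_s.+1 -> finComUnitRingType)
    (m := fun i => #|nonunits (R i)|) (q := fun i => (#|R i| %/ m i)%N) :
  (forall i, is_local (R i)) -> (forall i, q i %% 4 = 1)%N ->
  (forall i j : 'I_s.+1, i <= j -> q i <= q j)%N ->
  ramanujan (@qucg (prodring R)) ->
  iso_field2 (prodring R) 5 5 \/
  exists q : nat, [/\ prime_power q, q = 1 %[mod 4] & iso_field (prodring R) q].
Proof.
rewrite /q /m {q m} => locR q1 srt ram.
have [q_gt1 sq] := (fun i => residue_gt1 (locR i), local_squares locR q1).
have m_gt0 i := card_nonunits_gt0 (R i).
have mq i := residue_le_nonunits (locR i).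
have := ramanujan_quotient1 (@unit_lifting_proj _ R ord0) (locR ord0) ram (q1
  ord0).
have F i : #|nonunits (R i)| = 1%N -> exists F : finFieldType,
    #|F| = (#|R i| %/ #|nonunits (R i)|)%N /\ ring_iso (R i) F.
  by move=> mi; have [F [cF iF]] := field_of_nonunits mi; exists F;
    rewrite mi divn1.
rewrite (local_prod_degree locR q1).
case: s R locR q1 srt ram q_gt1 sq m_gt0 mq F =>
  [|[|s]] R locR q1 srt ram q_gt1 sq m_gt0 mq F.
- rewrite big_ord_recl big_ord0 muln1 => sd; right.
  have mi := small_degree_local (q1 _) (q_gt1 _) (m_gt0 _) (mq _) (sq _) sd.
  have [K [cK iK]] := F _ mi; exists #|K|; split.
  + exact: field_prime_power.
  + by rewrite cK q1.
  by exists K; split=> //; apply: ring_iso_trans iK; apply: ring_iso_prodring1.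
- rewrite !big_ord_recl big_ord0 muln1 => sd; left.
  have [[qa ma qb mb] _] := small_degree_two (q1 _) (q_gt1 _) (m_gt0 _) (m_gt0
    _)
    (mq _) (mq _) (srt ord0 _ isT) (sq _) (sq _) (q1 _) sd.
  have [K [cK iK]] := F _ ma; have [K' [cK' iK']] := F _ mb.
  exists K, K'; split; [by rewrite cK | by rewrite cK' |].
  apply: ring_iso_trans (ring_iso_pair iK iK'); exact: ring_iso_prodring2.
(* With three or more factors, the first two already determine q = 5, and the rest multiplies the
   degree by at least 2, against the last clause of [small_degree_two]. *)
rewrite 2!big_ord_recl mulnA => sd.
set rest := (\prod_(i < s.+1) _)%N in sd.
have rest2 : (1 < rest)%N.
  rewrite /rest big_ord_recl; have h := local_squares_gt1 locR q1.
  rewrite -[2%N]muln1 leq_mul // prodn_gt0 // => i; exact: ltnW (h _).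
have sd1 := small_degree_le (leq_pmulr _ (ltnW rest2)) sd.
have [_ []] := small_degree_two (q1 _) (q_gt1 _) (m_gt0 _) (m_gt0 _)
    (mq _) (mq _) (srt ord0 _ isT) (sq _) (sq _) (q1 _) sd1.
by apply: small_degree_le sd; rewrite leq_mul2l rest2 orbT.
Qed.

(** The quotients [R0] and [R ord0] give two bounds on the same degree. One factor in [R] uses both;
    with more factors the second bound is contradictory. *)
Lemma ramanujan_mixed_prod s (R : 'I_s.+1 -> finComUnitRingType)
    (R0 : finComUnitRingType)
    (m := fun i => #|nonunits (R i)|) (q := fun i => (#|R i| %/ m i)%N) :
  (forall i, is_local (R i)) -> (forall i, q i %% 4 = 1)%N ->
  (forall i j : 'I_s.+1, i <= j -> q i <= q j)%N ->
  is_local R0 -> (#|R0| %/ #|nonunits R0| %% 4 = 3)%N ->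
  ramanujan (@qucg (R0 * prodring R)%type) ->
  exists F1 F2 : finFieldType, [/\ #|F1| = 3%N, #|F2| \in [:: 5; 9; 13]%N &
    ring_iso (R0 * prodring R)%type (F1 * F2)%type].
Proof.
rewrite /q /m {q m} => locR q1 srt locR0 q03 ram.
have [q_gt1 sq] := (fun i => residue_gt1 (locR i), local_squares locR q1).
have m_gt0 i := card_nonunits_gt0 (R i).
have mq i := residue_le_nonunits (locR i).
have F (S : finComUnitRingType) : #|nonunits S| = 1%N ->
  exists F : finFieldType,
    #|F| = (#|S| %/ #|nonunits S|)%N /\ ring_iso S F.
  by move=> mi; have [F [cF iF]] := field_of_nonunits mi; exists F;
    rewrite mi divn1.
have l0 : unit_lifting (fst : {rmorphism (R0 * prodring R)%type -> R0}).
  by move=> u Uu; exists (u, 1) => //; apply/andP; rewrite Uu unitr1.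
have l1 : unit_lifting
    (pr_proj ord0 \o snd : {rmorphism (R0 * prodring R)%type -> R ord0}).
  move=> u /(@unit_lifting_proj _ R)[v Uv <-].
  by exists (1, v) => //; apply/andP; rewrite Uv unitr1.
have := ramanujan_quotient1 l1 (locR ord0) ram (q1 ord0).
have := ramanujan_quotient3 l0 locR0 ram q03.
rewrite qucg_degree_pair ?local_prod_minus1 // (local_prod_degree locR q1).
rewrite (qucg_degree3 locR0 q03).
have K1 : (1 < (#|R0| %/ #|nonunits R0|).-1 * #|nonunits R0|)%N.
  have := card_nonunits_gt0 R0; move: q03; move: #|nonunits R0| => b;
    move: (#|R0| %/ b)%N => a; nia.
case: s R locR q1 srt ram q_gt1 sq m_gt0 mq l0 l1 =>
  [|s] R locR q1 srt ram q_gt1 sq m_gt0 mq l0 l1.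
  rewrite big_ord_recl big_ord0 muln1 => lt0 sd.
  have [q03' m0 m1 q_in] := small_degree_mixed (q1 _) (q_gt1 _) q03
    (card_nonunits_gt0 R0) (residue_le_nonunits locR0) (m_gt0 _) (mq _) (sq _)
      lt0 sd.
  have [K0 [cK0 iK0]] := F _ m0; have [K [cK iK]] := F _ m1.
  exists K0, K; split; [by rewrite cK0 | by rewrite cK |].
  by apply: ring_iso_pair iK0 _; apply: ring_iso_trans iK;
    apply: ring_iso_prodring1.
(* At least two factors in [R]: the degree of [R0] is at least 2 by [K1], so [small_degree_mixed2]
   applies after dropping the remaining factors. *)
rewrite 2!big_ord_recl mulnA => _ sd.
set rest := (\prod_(i < s) _)%N in sd.
have rest1 : (0 < rest)%N.
  by rewrite prodn_gt0 // => i; apply/ltnW/(local_squares_gt1 locR q1).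
rewrite mulnA in sd.
have := small_degree_le (leq_pmulr _ rest1) sd; rewrite -mulnA => sd1.
case: (small_degree_mixed2 (q1 _) (q_gt1 _) (m_gt0 _) (m_gt0 _) K1
  (srt ord0 _ isT) (sq _) (sq _) (q1 _) sd1).
Qed.

Theorem theorem5p1
  (s : nat) (R : 'I_s.+1 -> finComUnitRingType) (M : forall i, {set R i})
  (R_local : forall i, local_ring (M i))
  (R_sorted : forall i j : 'I_s.+1, (i <= j)%N ->
     (#|R i| %/ #|M i| <= #|R j| %/ #|M j|)%N)
  (R_mod4 : forall i, #|R i| %/ #|M i| = 1 %[mod 4])
  (R0 : finComUnitRingType) (M0 : {set R0})
  (R0_local : local_ring M0)
  (R0_mod4 : #|R0| %/ #|M0| = 3 %[mod 4]) :
  [/\ ramanujan (@qucg R0) <->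
        (#|R0|%:R : rat) >= (#|M0|%:R + 2) ^+ 2 / 4,
      ramanujan (@qucg (prodring R)) <->
        iso_field2 (prodring R) 5 5 \/
        exists q : nat, [/\ prime_power q, q = 1 %[mod 4]
                         & iso_field (prodring R) q]
    & ramanujan (@qucg (R0 * prodring R)%type) <->
        [\/ iso_field2 (R0 * prodring R)%type 3 5,
            iso_field2 (R0 * prodring R)%type 3 9
          | iso_field2 (R0 * prodring R)%type 3 13]].
Proof.
have localR i := local_ring_is_local (R_local i).
have localR0 := local_ring_is_local R0_local.
have srt (i j : 'I_s.+1) : (i <= j)%N ->
  (#|R i| %/ #|nonunits (R i)| <= #|R j| %/ #|nonunits (R j)|)%N.
  by move/R_sorted; rewrite (local_ringE (R_local i)) (local_ringE (R_local j)).
have q1 i : (#|R i| %/ #|nonunits (R i)| %% 4 = 1)%N.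
  by rewrite -(local_ringE (R_local i)) R_mod4.
have q03 : (#|R0| %/ #|nonunits R0| %% 4 = 3)%N.
  by rewrite -(local_ringE R0_local) R0_mod4.
split.
- rewrite ler_pdivrMr ?ltr0n // -(natrD _ _ 2) -natrX -natrM ler_nat mulnC.
  rewrite (local_ringE R0_local); exact: ramanujan_local3.
- split=> [|[[F1 [F2 [c1 c2 iso]]]|[q [_ qm4 [F [cF iso]]]]]].
  + exact: ramanujan_local_prod.
  + exact: (@ramanujan_iso _ (F1 * F2)%type iso (ramanujan_field_pair5 c1 c2)).
  by apply: (@ramanujan_iso _ F iso); apply: ramanujan_field; rewrite cF qm4.
split=> [/(ramanujan_mixed_prod localR q1 srt localR0 q03)[F1 [F2 [c1 c2
  iso]]]|].
  by move: c2; rewrite !inE => /or3P[]/eqP c2;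
    [constructor 1 | constructor 2 | constructor 3]; exists F1, F2.
by case=> -[F1 [F2 [c1 c2 iso]]]; apply: (@ramanujan_iso _ (F1 * F2)%type iso);
  apply: ramanujan_field_pair3; rewrite // c2.
Qed.
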